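(* Let $n\ge 1$, $T>0$, $\alpha\ge 0$, let $\Lambda\in\mathbb{R}^{n\times n}$ be symmetric positive definite, $\Sigma\in\mathbb{R}^{n\times n}$ symmetric nonnegative definite, and $\theta_1,\dots,\theta_n\ge 0$ with $\theta=\sum_{i=1}^n\theta_i$. Let $D=\sqrt{\Lambda^{-1}}\,\Sigma\,\sqrt{\Lambda^{-1}}$, let $d_{\min},d_{\max}$ be the smallest and largest eigenvalues of $D$ and $\lambda_{\min},\lambda_{\max}$ those of $\Lambda$, and let $l>l_0$ where $$l_0:=\max\Big\{\lambda_{\max}\Big(\sqrt{\tfrac{\theta^2}{4}+\alpha d_{\min}}-\tfrac{\theta}{2}\Big),\ \lambda_{\min}\sqrt{\alpha d_{\max}}\Big\}.$$ Then the matrix initial value problem $$C'=C^\top\Lambda^{-1}C+C^\top\tilde C C-\alpha\Sigma,\qquad C(T)=lI,\qquad \tilde C:=\operatorname{diag}\Big(\frac{\theta_i}{c_{i,i}}\Big)_{i=1,\dots,n},$$ (where $C=(c_{i,j})$) possesses a unique solution $C(l,\cdot)$ on $(-\infty,T]$. The solution is symmetric for all $t\in(-\infty,T]$ and $$0<P(l,t)\le \sqrt{\Lambda^{-1}}\,C(l,t)\,\sqrt{\Lambda^{-1}}\le Q(l,t)\qquad\text{for all }t\in(-\infty,T],$$ where $P(l,\cdot)$ and $Q(l,\cdot)$ are the solutions of the initial value problems $$P'=P^2+\theta P-\alpha d_{\min}I,\quad P(T)=\frac{l}{\lambda_{\max}}I,\qquad Q'=Q^2-\alpha d_{\max}I,\quad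 Q(T)=\frac{l}{\lambda_{\min}}I.$$
   Context: $\sqrt{\Lambda^{-1}}$ denotes the symmetric positive definite square root of $\Lambda^{-1}$. For symmetric matrices $A,B$, $A>B$ ($A\ge B$) means $A-B$ is positive (nonnegative) definite; $I$ is the $n\times n$ identity matrix. *)

(* Defs.v *)
From HB Require Import structures.
From mathcomp Require Import all_boot all_order all_algebra.
From mathcomp Require Import all_classical all_reals all_analysis.
Set Implicit Arguments. Unset Strict Implicit. Unset Printing Implicit Defensive.
Import Order.TTheory GRing.Theory Num.Theory numFieldNormedType.Exports.
Local Open Scope ring_scope.
Local Open Scope classical_set_scope.

Section Defs.
Variables (R : realType) (n : nat).

Definition symmx (A : 'M[R]_n) : Prop := A^T = A.

Definition nnd (A : 'M[R]_n) : Prop :=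
  symmx A /\ forall v : 'cV[R]_n, 0 <= (v^T *m A *m v) ord0 ord0.

Definition pd (A : 'M[R]_n) : Prop :=
  symmx A /\ forall v : 'cV[R]_n, v != 0 -> 0 < (v^T *m A *m v) ord0 ord0.

Definition loewner_le (A B : 'M[R]_n) : Prop := nnd (B - A).

Definition is_min_eig (A : 'M[R]_n) (a : R) : Prop :=
  eigenvalue A a /\ forall b, eigenvalue A b -> a <= b.
Definition is_max_eig (A : 'M[R]_n) (a : R) : Prop :=
  eigenvalue A a /\ forall b, eigenvalue A b -> b <= a.

Definition mx_ivp_sol (F : 'M[R]_n -> 'M[R]_n) (T : R) (C0 : 'M[R]_n)
    (C : R -> 'M[R]_n) : Prop :=
  C T = C0 /\
  (forall t : R, t < T -> forall i j : 'I_n,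
      is_derive t (1 : R) (fun s => C s i j) (F (C t) i j)) /\
  (forall i j : 'I_n, {within [set s : R | s <= T], continuous (fun s => C s i j)}).

Definition riccati_rhs (Lam Sig : 'M[R]_n) (alpha : R) (theta : 'I_n -> R)
    (C : 'M[R]_n) : 'M[R]_n :=
  C^T *m invmx Lam *m C
  + C^T *m diag_mx (\row_i (theta i / C i i)) *m C
  - alpha *: Sig.

(* solution of the main IVP: additionally the diagonal entries c_ii never
   vanish on (-oo, T], so that Ctilde is defined *)
Definition main_sol (Lam Sig : 'M[R]_n) (alpha : R) (theta : 'I_n -> R)
    (T l : R) (C : R -> 'M[R]_n) : Prop :=
  mx_ivp_sol (riccati_rhs Lam Sig alpha theta) T (l%:M) C /\
  (forall t, t <= T -> forall i : 'I_n, C t i i != 0).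

End Defs.

(* Main.v *)
Require Import Defs.
From HB Require Import structures.
From mathcomp Require Import all_boot all_order all_algebra.
From mathcomp Require Import all_classical all_reals all_analysis.
From mathcomp Require Import ring lra.
Import Order.TTheory GRing.Theory Num.Theory numFieldNormedType.Exports.
Local Open Scope ring_scope.
Local Open Scope classical_set_scope.
Set Implicit Arguments.
Unset Strict Implicit.

(** The right-hand side is always symmetric, so solutions are symmetric.  Where
    X is positive definite, Cauchy-Schwarz gives X Ctilde X <= theta X, so the
    scalar solutions p and q yield barriers p Lam <= X <= q Lam.  Shifting them
    to p - e and q + e makes them strict: at the largest time below T at which
    one of them is touched, X v = r Lam v for some v <> 0, with r = p - e
    or r = q + e, and the derivative of the form at v has the wrong sign.
    Existence on [t0, T] follows by solving, with Picard iteration, the equation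
    truncated outside a box that the barriers do not let the solution leave;
    the solutions for different t0 are glued by Gronwall uniqueness.  Since
    S Lam S = I, conjugating the barriers by S gives the stated bounds. *)

(** * Derivatives and antiderivatives *)

(** Ctilde is singular where a diagonal entry vanishes, so the lower barrier is needed already for
    existence and not only for the bounds. The two barriers are interdependent: the sign computation
    is made for the true equation, and the truncation is known to be inactive only while both
    shifted barriers hold. They are therefore followed together, as a family indexed by [bool]. The
    condition l > l0 puts p(T) and q(T) above the larger roots of their right-hand sides; backward
    in time p and q decrease but stay above these roots, so neither blows up. The larger root for p
    is nonnegative but can be 0, and then p tends to 0 at -oo: the box degenerates, and no single
    truncation serves all of (-oo, T]. This is why solutions on bounded intervals have to be glued.
    The facts on definiteness all come from Cauchy-Schwarz for nonnegative forms. *)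

Lemma is_derive_continuous {R : realType} (f : R -> R) (x df : R) :
  is_derive x 1 f df -> {for x, continuous f}.
Proof. by case=> h _; apply: differentiable_continuous; exact/derivable1_diffP. Qed.

Lemma is_derive_within_continuous {R : realType} (f df : R -> R) (a b : R) :
  (forall x, a <= x <= b -> is_derive x 1 f (df x)) ->
  {within `[a, b], continuous f}.
Proof.
move=> h; apply: derivable_within_continuous => x; rewrite in_itv/= => xab.
by case: (h x xab).
Qed.

Lemma le_of_is_derive {R : realType} (f df : R -> R) (a b : R) :
  a <= b -> {within `[a, b], continuous f} ->
  (forall x, a < x < b -> is_derive x 1 f (df x)) ->
  (forall x, a < x < b -> 0 <= df x) -> f a <= f b.
Proof.
rewrite le_eqVlt => /predU1P[-> //|ab] cf hd h0.
have hd' x : x \in `]a, b[%R -> is_derive x 1 f (df x).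
  by rewrite in_itv/= => /hd.
have [c] := MVT ab hd' cf.
rewrite in_itv/= => cab e; rewrite -subr_ge0 e mulr_ge0 ?h0//.
by rewrite subr_ge0 ltW.
Qed.

Lemma dist_le_of_is_derive {R : realType} (f g df dg : R -> R) (a b : R) :
  a <= b ->
  (forall x, a <= x <= b -> is_derive x 1 f (df x)) ->
  (forall x, a <= x <= b -> is_derive x 1 g (dg x)) ->
  (forall x, a <= x <= b -> `|df x| <= dg x) -> `|f b - f a| <= g b - g a.
Proof.
move=> ab hf hg hfg.
have sub x : a < x < b -> a <= x <= b by move=> /andP[/ltW -> /ltW ->].
have hp x : a <= x <= b -> is_derive x 1 (g + f) (dg x + df x).
  by move=> xab; apply: is_deriveD; [exact: hg|exact: hf].
have hm x : a <= x <= b -> is_derive x 1 (g - f) (dg x - df x).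
  by move=> xab; apply: is_deriveB; [exact: hg|exact: hf].
have := @le_of_is_derive _ (g + f) _ a b ab (is_derive_within_continuous hp)
  (fun x h => hp x (sub x h)).
have := @le_of_is_derive _ (g - f) _ a b ab (is_derive_within_continuous hm)
  (fun x h => hm x (sub x h)).
have h1 : forall x, a < x < b -> 0 <= dg x - df x.
  by move=> x /sub /hfg; rewrite ler_norml; lra.
have h2 : forall x, a < x < b -> 0 <= dg x + df x.
  by move=> x /sub /hfg; rewrite ler_norml; lra.
move=> /(_ h1) + /(_ h2).
by rewrite !fctE ler_norml; lra.
Qed.

Lemma eq_of_is_derive {R : realType} (f g df : R -> R) (a b x y : R) :
  (forall x, a < x < b -> is_derive x 1 f (df x)) ->
  (forall x, a < x < b -> is_derive x 1 g (df x)) ->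
  a < x < b -> a < y < b -> f x - f y = g x - g y.
Proof.
move=> hf hg; wlog xy : x y / x <= y => [H|] xab yab.
  have [/H|/ltW/H] := leP x y; first exact.
  by move=> /(_ yab xab); lra.
have sub z : x <= z <= y -> a < z < b by lra.
have h : forall z, x <= z <= y -> is_derive z 1 (f - g) 0.
  move=> z /sub zab; rewrite -(subrr (df z)).
  by apply: is_deriveB; [exact: hf|exact: hg].
have h0 : forall z, x <= z <= y -> is_derive z 1 (cst (0 : R)) 0.
  by move=> z _; exact: is_derive_cst.
have := @dist_le_of_is_derive _ _ _ _ _ x y xy h h0.
have h1 : forall z, x <= z <= y -> `|0 : R| <= 0 by move=> *; rewrite normr0.
move=> /(_ h1); rewrite subrr normr_le0 subr_eq0 => /eqP.
rewrite !fctE; lra.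
Qed.

(** An integral with left endpoint a is an antiderivative only to the right of a. To cover the whole
    line the endpoint moves with x, and subtracting the value at 0 removes the dependence on the
    endpoint. *)
Lemma exists_antiderivative {R : realType} (f : R -> R) :
  continuous f -> exists G : R -> R, forall x : R, is_derive x 1 G (f x).
Proof.
move=> cf.
have H a : exists G : R -> R, forall x : R, a < x -> is_derive x 1 G (f x).
  exists (fun x => (\int[lebesgue_measure]_(t in [set` `[a, x]]) f t)%R) => x ax.
  have x1 : x < x + 1 by lra.
  have fi : lebesgue_measure.-integrable `[a, x + 1] (EFin \o f).
    apply: continuous_compact_integrable; first exact: segment_compact.
    exact: continuous_subspaceT.
  have [d e] := continuous_FTC1_closed x1 fi ax (cf x).
  by rewrite -e derive1E; exact/derivableP.
have [G hG] := choice H.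
(* This base point lies to the left of 0 and of every y within distance 1 of x. *)
pose b (x : R) := - `|x| - 2.
exists (fun x => G (b x) x - G (b x) 0) => x.
apply: (@near_eq_is_derive _ _ _ (fun y => G (b x) y - G (b x) 0)).
  near=> y.
  have yx : `|y - x| < 1.
    by rewrite distrC; near: y; apply: nbhsx_ballx.
  pose m := Num.max (b x) (b y).
  have nx : - x <= `|x| /\ x <= `|x| /\ 0 <= `|x| by rewrite -{1}normrN !ler_norm normr_ge0.
  have ny : - y <= `|y| /\ y <= `|y| /\ 0 <= `|y| by rewrite -{1}normrN !ler_norm normr_ge0.
  have nyx : - (y - x) <= `|y - x| /\ (y - x) <= `|y - x|.
    by rewrite -{1}normrN !ler_norm.
  have yx' : `|x| <= `|y| + `|y - x|.
    by rewrite (_ : x = y - (y - x)) ?[in X in _ <= X](_ : y - (y - x) = x) ?ler_normB//; ring.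
  apply: (@eq_of_is_derive _ _ _ f m (`|y| + 1)) => [z|z||].
  - by rewrite gt_max => /andP[/andP[h _] _]; exact: hG.
  - by rewrite gt_max => /andP[/andP[_ h] _]; exact: hG.
  - rewrite gt_max /b; lra.
  - rewrite gt_max /b; lra.
rewrite -[f x]subr0; apply: is_deriveB; apply: hG.
have := ler_norm (- x); have := normr_ge0 x; rewrite /b normrN; lra.
Unshelve. all: by end_near.
Qed.

Lemma is_derive_mull {R : realType} (f : R -> R) (k x df : R) :
  is_derive x 1 f df -> is_derive x 1 (fun y => k * f y) (k * df).
Proof. exact: (@is_deriveZ R R R f k x 1 df). Qed.

Lemma is_derive_mul {R : realType} (f g : R -> R) (x df dg : R) :
  is_derive x 1 f df -> is_derive x 1 g dg ->
  is_derive x 1 (fun y => f y * g y) (df * g x + f x * dg).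
Proof.
move=> hf hg; apply: is_derive_eq (is_deriveM hf hg) _.
by rewrite /GRing.scale /=; ring.
Qed.

Lemma is_derive_expR_affine {R : realType} (k T x : R) :
  is_derive x 1 (fun s => expR (k * (s - T))) (k * expR (k * (x - T))).
Proof.
have h1 : is_derive x 1 (fun s : R => k * (s - T)) k.
  rewrite -[X in is_derive _ _ _ X]mulr1; apply: is_derive_mull.
  by rewrite -[X in is_derive _ _ _ X]subr0; apply: is_deriveB.
by rewrite mulrC; exact: (is_derive1_comp (is_derive_expR _) h1).
Qed.

(** Integrating the weight exp(c |s - T|) away from T gains a factor 1/c. In the weighted norm the
    Picard operator of an L-Lipschitz field thus has constant L/c, on the whole line at once. *)
Lemma exp_bound_of_is_derive {R : realType} (g dg : R -> R) (T c B t : R) :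
  0 < c -> (forall s : R, is_derive s 1 g (dg s)) -> g T = 0 ->
  (forall s, `|dg s| <= B * expR (c * `|s - T|)) ->
  `|g t| <= B / c * expR (c * `|t - T|).
Proof.
move=> c0 hg g0 hb.
have B0 : 0 <= B.
  by have := le_trans (normr_ge0 _) (hb T); rewrite subrr normr0 mulr0 expR0 mulr1.
have Bc0 : 0 <= B / c by rewrite divr_ge0// ltW.
have hexp (k s : R) : is_derive s 1 (fun s => B / c * expR (k * (s - T)))
    (B / c * k * expR (k * (s - T))).
  by rewrite -mulrA; apply/is_derive_mull/is_derive_expR_affine.
have [tT|/ltW tT] := leP T t.
  have := @dist_le_of_is_derive _ g _ dg _ T t tT (fun x _ => hg x) (fun x _ => hexp c x).
  have -> : `|t - T| = t - T by rewrite ger0_norm ?subr_ge0.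
  rewrite g0 subr0 subrr mulr0 expR0 => h.
  apply: le_trans (h _) _; last by rewrite gerBl mulr1.
  move=> x /andP[Tx _]; have := hb x; rewrite (ger0_norm (_ : 0 <= x - T)) ?subr_ge0//.
  by rewrite divfK ?gt_eqF.
have hn s := is_deriveN (hexp (- c) s).
have := @dist_le_of_is_derive _ g _ dg _ t T tT (fun x _ => hg x) (fun x _ => hn x).
have -> : `|t - T| = - (t - T) by rewrite ler0_norm ?subr_le0.
rewrite g0 sub0r normrN => h.
apply: le_trans (h _) _.
  move=> x /andP[_ xT]; have := hb x; rewrite (ler0_norm (_ : x - T <= 0)) ?subr_le0//.
  have -> E : - (B / c * - c * E) = B * E.
    by rewrite mulrN mulNr opprK divfK ?gt_eqF.
  by rewrite mulrN mulNr.
rewrite !opprfctE opprK subrr mulr0 expR0 mulr1 mulrN mulNr; lra.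
Qed.

(** * Picard iteration *)

(** Stands in for passing to the limit, both in the Picard iteration and when the shift of the
    barriers tends to 0. *)
Lemma le_of_geometric {R : realType} (a b C : R) :
  (forall k, a <= b + C * 2^-1 ^+ k) -> a <= b.
Proof.
move=> h; rewrite leNgt; apply/negP => ba.
have d0 : 0 < a - b by lra.
pose k := Num.bound `|C / (a - b)|.
have Ck : C < (a - b) * 2 ^+ k.
  rewrite mulrC -ltr_pdivrMr//; apply: le_lt_trans (ler_norm _) _.
  apply: lt_trans (archi_boundP (normr_ge0 _)) _.
  by rewrite -natrX ltr_nat /k; apply: ltn_expl.
have := h k; rewrite exprVn -lerBlDl ler_pdivlMr ?exprn_gt0//; lra.
Qed.

(* The enclosures [u k - 2 B / 2^k, u k + 2 B / 2^k] are nested. *)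
Lemma exists_geometric_limit {R : realType} (u : nat -> R) (B : R) :
  (forall k, `|u k.+1 - u k| <= B * 2^-1 ^+ k) ->
  exists l, forall k, `|l - u k| <= 2 * B * 2^-1 ^+ k.
Proof.
move=> h; pose a k := u k - 2 * B * 2^-1 ^+ k; pose b k := u k + 2 * B * 2^-1 ^+ k.
have B0 k : 0 <= B * 2^-1 ^+ k by exact: le_trans (h k).
have step k : a k <= a k.+1 /\ b k.+1 <= b k.
  by have := h k; rewrite ler_norml /a /b exprS; lra.
have amono k m : a k <= a (k + m)%N /\ b (k + m)%N <= b k.
  elim: m => [|m [IH1 IH2]]; first by rewrite addn0.
  by rewrite addnS; have := step (k + m)%N; lra.
have ab k m : a k <= b m.
  have [h1 _] := amono k m; have [_ h2] := amono m k.
  by rewrite addnC in h2; have := B0 (k + m)%N; move: h1 h2; rewrite /a /b; lra.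
have E0 : has_sup (range a).
  by split; [exists (a 0%N), 0%N|exists (b 0%N) => _ [k _ <-]].
exists (sup (range a)) => k.
have h1 : a k <= sup (range a) by apply: ub_le_sup; [case: E0|exists k].
have h2 : sup (range a) <= b k.
  by apply: ge_sup; [case: E0|move=> _ [m _ <-]].
by move: h1 h2; rewrite /a /b ler_norml; lra.
Qed.

(** The maximum-norm distance, kept as a relation so that all estimates stay entrywise. *)
Definition mx_close {R : realType} {n : nat} (A B : 'M[R]_n) (e : R) :=
  forall i j, `|A i j - B i j| <= e.

Definition entry_continuous {R : realType} {n : nat} (X : R -> 'M[R]_n) :=
  forall i j, continuous (fun s => X s i j).

Definition entry_derive {R : realType} {n : nat} (X : R -> 'M[R]_n) (t : R)
    (D : 'M[R]_n) :=
  forall i j, is_derive t 1 (fun s => X s i j) (D i j).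

Lemma exists_mx_antiderivative {R : realType} {n : nat} (Y : R -> 'M[R]_n)
    (T : R) (X0 : 'M[R]_n) :
  entry_continuous Y ->
  exists G : R -> 'M[R]_n, G T = X0 /\ forall t, entry_derive G t (Y t).
Proof.
move=> cY.
have H (ij : 'I_n * 'I_n) : exists G : R -> R,
    forall t : R, is_derive t 1 G (Y t ij.1 ij.2).
  exact/exists_antiderivative/cY.
have [G hG] := choice H.
exists (fun t => \matrix_(i, j) (G (i, j) t - G (i, j) T + X0 i j)); split.
  by apply/matrixP => i j; rewrite mxE; ring.
move=> t i j.
rewrite (_ : (fun s => _) = (fun s => G (i, j) s - G (i, j) T + X0 i j)); last first.
  by apply/funext => s; rewrite mxE.
rewrite -[Y t i j]addr0 -{1}[Y t i j]subr0.
by apply: is_deriveD; apply: is_deriveB; exact: hG.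
Qed.

Lemma near_mx_close {R : realType} {n : nat} (X : R -> 'M[R]_n) (t e : R) :
  (forall i j, {for t, continuous (fun s => X s i j)}) -> 0 < e ->
  \forall s \near t, mx_close (X t) (X s) e.
Proof.
move=> cX e0.
have h (kl : 'I_n * 'I_n) :
    \forall s \near t, `|X t kl.1 kl.2 - X s kl.1 kl.2| <= e.
  by have /cvgrPdist_le := cX kl.1 kl.2; apply.
have H : \forall s \near t, forall kl : 'I_n * 'I_n,
    `|X t kl.1 kl.2 - X s kl.1 kl.2| <= e.
  exact: (@filter_forall R _ (fun kl s => `|X t kl.1 kl.2 - X s kl.1 kl.2| <= e)
    (nbhs t)).
near=> s => i j.
have : forall kl : 'I_n * 'I_n, `|X t kl.1 kl.2 - X s kl.1 kl.2| <= e by near: s.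
by move=> /(_ (i, j)).
Unshelve. all: by end_near.
Qed.

Lemma lipschitz_entry_continuous {R : realType} {n : nat}
    (F : 'M[R]_n -> 'M[R]_n) (L : R) (X : R -> 'M[R]_n) : 0 < L ->
  (forall A B e, mx_close A B e -> mx_close (F A) (F B) (L * e)) ->
  entry_continuous X -> entry_continuous (F \o X).
Proof.
move=> L0 hL cX i j t; apply/cvgrPdist_le => e e0.
have := near_mx_close (fun i j => cX i j t) (divr_gt0 e0 L0).
apply: filterS => s hs /=.
rewrite -[e](@divfK _ L) ?gt_eqF// mulrC; exact: hL.
Qed.

(** In the norm weighted by exp(2 L |t - T|) the integral operator contracts by 1/2, so the iterates
    converge geometrically at every t, without cutting the line into short intervals. *)
Lemma picard_lindelof {R : realType} {n : nat} (F : 'M[R]_n -> 'M[R]_n)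
    (B L T : R) (X0 : 'M[R]_n) : 0 < L ->
  (forall A i j, `|F A i j| <= B) ->
  (forall A A' e, mx_close A A' e -> mx_close (F A) (F A') (L * e)) ->
  exists X : R -> 'M[R]_n, X T = X0 /\ forall t, entry_derive X t (F (X t)).
Proof.
move=> L0 hB hL.
have H (Y : R -> 'M[R]_n) : exists G : R -> 'M[R]_n, entry_continuous Y ->
    G T = X0 /\ forall t, entry_derive G t (F (Y t)).
  (* A discontinuous Y gets a dummy image, which makes the operator total. *)
  have [cY|ncY] := pselect (entry_continuous Y); last by exists Y.
  by have [G] := exists_mx_antiderivative T X0 (lipschitz_entry_continuous L0 hL cY);
    exists G.
have [N hN] := choice H.
pose u k := iter k N (cst X0).
have cN Y : entry_continuous Y -> entry_continuous (N Y).
  move=> cY i j t; have [_ h] := hN Y cY.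
  exact: is_derive_continuous (h t i j).
have cu k : entry_continuous (u k).
  by elim: k => [i j t|k IH]; [exact: cvg_cst|exact: cN].
have uT k : u k T = X0 by case: k => [//|k]; have [] := hN _ (cu k).
have du k t : entry_derive (u k.+1) t (F (u k t)) by have [] := hN _ (cu k).
pose c := 2 * L; pose K := B / c; pose E t := expR (c * `|t - T|).
have c0 : 0 < c by rewrite /c; lra.
have E1 t : 1 <= E t.
  by rewrite -expR0 ler_expR mulr_ge0// ltW.
have step k t : mx_close (u k.+1 t) (u k t) (K * 2^-1 ^+ k * E t).
  elim: k t => [|k IH] t i j.
    rewrite expr0 mulr1.
    pose g s := u 1%N s i j - X0 i j.
    apply: (@exp_bound_of_is_derive _ g (fun s => F (u 0%N s) i j)) => //.
    - move=> s; rewrite -[F _ _ _]subr0; apply: is_deriveB; exact: du.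
    - by rewrite /g uT subrr.
    - move=> s; apply: le_trans (hB _ _ _) _; rewrite ler_peMr//; last exact: E1.
      exact: le_trans (hB (u 0%N s) i j).
  pose g s := u k.+2 s i j - u k.+1 s i j.
  have -> : K * 2^-1 ^+ k.+1 = (L * (K * 2^-1 ^+ k)) / c.
    by rewrite /c exprS; field; rewrite gt_eqF.
  apply: (@exp_bound_of_is_derive _ g
    (fun s => F (u k.+1 s) i j - F (u k s) i j)) => //.
  - by move=> s; apply: is_deriveB; exact: du.
  - by rewrite /g !uT subrr.
  - by move=> s; rewrite -mulrA; apply: hL.
have H2 (q : R * ('I_n * 'I_n)) : exists x, forall k,
    `|x - u k q.1 q.2.1 q.2.2| <= 2 * (K * E q.1) * 2^-1 ^+ k.
  apply: exists_geometric_limit => k.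
  by rewrite mulrAC; exact: step.
have [x hx] := choice H2.
pose X t : 'M[R]_n := \matrix_(i, j) x (t, (i, j)).
have hX k t : mx_close (X t) (u k t) (2 * (K * E t) * 2^-1 ^+ k).
  by move=> i j; rewrite mxE; exact: hx (t, (i, j)) k.
have XT : X T = X0.
  apply/matrixP => i j; apply/eqP; rewrite -subr_eq0 -normr_le0.
  by apply: (@le_of_geometric _ _ _ (2 * (K * E T))) => k; rewrite add0r -(uT k); exact: hX.
(* All iterates share the Lipschitz constant B in time; it passes to the limit and makes X
   continuous. *)
have lip_u k s t i j : s <= t -> `|u k t i j - u k s i j| <= B * t - B * s.
  case: k => [|k] st.
    rewrite subrr normr0 -mulrBr mulr_ge0 ?subr_ge0//.
    exact: le_trans (hB X0 i j).
  apply: (@dist_le_of_is_derive _ (fun z => u k.+1 z i j) (fun z => B * z)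
    (fun z => F (u k z) i j) (cst B)) => //.
  - by move=> z _; exact: du.
  - by move=> z _; rewrite -[cst B z]mulr1; exact: is_derive_mull.
have lipX s t i j : s <= t -> `|X t i j - X s i j| <= B * t - B * s.
  move=> st; apply: (@le_of_geometric _ _ _ (2 * (K * E t) + 2 * (K * E s))) => k.
  have := lip_u k _ _ i j st; have := hX k t i j; have := hX k s i j.
  rewrite !ler_norml; lra.
have cX : entry_continuous X.
  move=> i j t; apply/cvgrPdist_le => e e0.
  have B0 : 0 <= B by exact: le_trans (hB X0 i j).
  have e1 : 0 < e / (B + 1) by rewrite divr_gt0//; lra.
  near=> s.
  have st : `|t - s| < e / (B + 1).
    by near: s; exact: (@nbhsx_ballx R R t _ e1).
  rewrite ltr_pdivlMr in st; last by lra.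
  have [ts|/ltW ts] := leP s t.
    move: st; rewrite ger0_norm ?subr_ge0// => st.
    apply: le_trans (lipX _ _ i j ts) _; nra.
  rewrite distrC; move: st; rewrite ler0_norm ?subr_le0// => st.
  apply: le_trans (lipX _ _ i j ts) _; nra.
have [WT dW] := hN X cX.
(* Both X and [N X] differ from [u k.+1] by a multiple of 2^-k, for every k. *)
have XW : X = N X.
  apply/funext => t; apply/matrixP => i j; apply/eqP; rewrite -subr_eq0 -normr_le0.
  apply: (@le_of_geometric _ _ _ (2 * (K * E t))) => k; rewrite add0r.
  pose C := 2 * (K * 2^-1 ^+ k).
  have h : `|u k.+1 t i j - N X t i j| <= L * C / c * E t.
    pose g s := u k.+1 s i j - N X s i j.
    apply: (@exp_bound_of_is_derive _ g (fun s => F (u k s) i j - F (X s) i j)) => //.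
    - by move=> s; apply: is_deriveB; [exact: du|exact: dW].
    - by rewrite /g uT WT subrr.
    - move=> s; rewrite -mulrA; apply: hL => a b; rewrite distrC.
      have := hX k s a b; rewrite /C -/(E s); lra.
  have h2 := hX k.+1 t i j; rewrite exprS in h2.
  have e : L * C / c * E t = K * 2^-1 ^+ k * E t.
    by rewrite /C /c; field; rewrite gt_eqF.
  rewrite e in h; move: h h2; rewrite !ler_norml; lra.
by exists X; split=> // t; rewrite {1}XW; exact: dW.
Unshelve. all: by end_near.
Qed.

(** * Quadratic forms *)

Definition bform {R : realType} {n : nat} (A : 'M[R]_n) (w v : 'cV[R]_n) : R :=
  (w^T *m A *m v) ord0 ord0.

Local Notation sqn v := (bform 1%:M v v).

Lemma bformDl {R : realType} {n : nat} (A : 'M[R]_n) u w v :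
  bform A (u + w) v = bform A u v + bform A w v.
Proof. by rewrite /bform linearD /= !mulmxDl mxE. Qed.

Lemma bformDr {R : realType} {n : nat} (A : 'M[R]_n) u w v :
  bform A u (w + v) = bform A u w + bform A u v.
Proof. by rewrite /bform mulmxDr mxE. Qed.

Lemma bformZl {R : realType} {n : nat} (A : 'M[R]_n) k w v :
  bform A (k *: w) v = k * bform A w v.
Proof. by rewrite /bform linearZ /= -!scalemxAl mxE. Qed.

Lemma bformZr {R : realType} {n : nat} (A : 'M[R]_n) k w v :
  bform A w (k *: v) = k * bform A w v.
Proof. by rewrite /bform -scalemxAr mxE. Qed.

Lemma bform_add {R : realType} {n : nat} (A B : 'M[R]_n) w v :
  bform (A + B) w v = bform A w v + bform B w v.
Proof. by rewrite /bform mulmxDr mulmxDl mxE. Qed.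

Lemma bform_opp {R : realType} {n : nat} (A : 'M[R]_n) w v :
  bform (- A) w v = - bform A w v.
Proof. by rewrite /bform mulmxN mulNmx mxE. Qed.

Lemma bform_sub {R : realType} {n : nat} (A B : 'M[R]_n) w v :
  bform (A - B) w v = bform A w v - bform B w v.
Proof. by rewrite bform_add bform_opp. Qed.

Lemma bform_scale {R : realType} {n : nat} (A : 'M[R]_n) k w v :
  bform (k *: A) w v = k * bform A w v.
Proof. by rewrite /bform -scalemxAr -scalemxAl mxE. Qed.

Lemma bform_scalar {R : realType} {n : nat} (a : R) (w v : 'cV[R]_n) :
  bform a%:M w v = a * bform 1%:M w v.
Proof. by rewrite -bform_scale scalemx1. Qed.

Lemma bformC {R : realType} {n : nat} (A : 'M[R]_n) w v :
  symmx A -> bform A w v = bform A v w.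
Proof.
move=> sA; rewrite /bform -[LHS]trace_mx11 -[RHS]trace_mx11 -mxtrace_tr.
by rewrite !trmx_mul trmxK sA mulmxA.
Qed.

Lemma bform_mul {R : realType} {n : nat} (A B C : 'M[R]_n) w v :
  bform (A^T *m B *m C) w v = bform B (A *m w) (C *m v).
Proof. by rewrite /bform trmx_mul !mulmxA. Qed.

Lemma bformE {R : realType} {n : nat} (A : 'M[R]_n) w v :
  bform A w v = \sum_i \sum_j w i 0 * A i j * v j 0.
Proof.
rewrite /bform mxE exchange_big /=; apply: eq_bigr => j _.
rewrite mxE mulr_suml; apply: eq_bigr => i _.
by rewrite !mxE !ord1.
Qed.

Lemma bform_delta {R : realType} {n : nat} (A : 'M[R]_n) i v :
  bform A (delta_mx i 0) v = (A *m v) i 0.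
Proof. by rewrite /bform trmx_delta -rowE -row_mul mxE ord1. Qed.

Lemma bform_delta2 {R : realType} {n : nat} (A : 'M[R]_n) i j :
  bform A (delta_mx i 0) (delta_mx j 0) = A i j.
Proof. by rewrite bform_delta -colE mxE. Qed.

Lemma sqnE {R : realType} {n : nat} (v : 'cV[R]_n) : sqn v = \sum_i v i 0 ^+ 2.
Proof.
by rewrite /bform mulmx1 mxE; apply: eq_bigr => i _; rewrite mxE expr2.
Qed.

Lemma sqn_ge0 {R : realType} {n : nat} (v : 'cV[R]_n) : 0 <= sqn v.
Proof. by rewrite sqnE sumr_ge0// => i _; rewrite sqr_ge0. Qed.

Lemma sqr_le_sqn {R : realType} {n : nat} (v : 'cV[R]_n) i : v i 0 ^+ 2 <= sqn v.
Proof.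
by rewrite sqnE (bigD1 i)//= lerDl sumr_ge0// => j _; rewrite sqr_ge0.
Qed.

Lemma sqn_eq0 {R : realType} {n : nat} (v : 'cV[R]_n) : sqn v = 0 -> v = 0.
Proof.
move=> v0; apply/matrixP => i j; rewrite ord1 mxE; apply/eqP.
by rewrite -sqrf_eq0 eq_le sqr_ge0 andbT -v0 sqr_le_sqn.
Qed.

Lemma sqn_gt0 {R : realType} {n : nat} (v : 'cV[R]_n) : v != 0 -> 0 < sqn v.
Proof.
by move=> v0; rewrite lt_def sqn_ge0 andbT; apply: contra v0 => /eqP/sqn_eq0 ->.
Qed.

Lemma bform_entry_bound {R : realType} {n : nat} (A : 'M[R]_n) e v :
  (forall i j, `|A i j| <= e) -> `|bform A v v| <= (n * n)%:R * e * sqn v.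
Proof.
move=> h; rewrite bformE; apply: le_trans (ler_norm_sum _ _ _) _.
have -> : (n * n)%:R * e * sqn v = \sum_(i < n) \sum_(j < n) e * sqn v.
  by rewrite !sumr_const !card_ord -mulrnA mulr_natl mulrnAl.
apply: ler_sum => i _; apply: le_trans (ler_norm_sum _ _ _) _.
apply: ler_sum => j _; rewrite mulrAC normrM mulrC.
apply: ler_pM => //; rewrite normrM.
have := sqr_le_sqn v i; have := sqr_le_sqn v j.
rewrite -(real_normK (num_real (v i 0))) -(real_normK (num_real (v j 0))).
have := sqr_ge0 (`|v i 0| - `|v j 0|); nra.
Qed.

Lemma bform_bound {R : realType} {n : nat} (A : 'M[R]_n) :
  exists2 K, 0 < K & forall v, `|bform A v v| <= K * sqn v.
Proof.
pose e := \sum_i \sum_j `|A i j|.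
have e0 : 0 <= e by rewrite sumr_ge0// => i _; rewrite sumr_ge0.
exists ((n * n)%:R * e + 1); first by rewrite ltr_wpDl// mulr_ge0.
move=> v; apply: le_trans (@bform_entry_bound _ _ A e v _) _.
  move=> i j; rewrite /e (bigD1 i)//= (bigD1 j)//= -addrA lerDl addr_ge0 ?sumr_ge0//.
  by move=> k _; rewrite sumr_ge0.
by rewrite ler_wpM2r ?sqn_ge0// lerDl.
Qed.

Lemma nnd_CauchySchwarz {R : realType} {n : nat} (A : 'M[R]_n) w v :
  nnd A -> bform A w v ^+ 2 <= bform A w w * bform A v v.
Proof.
move=> [sA pA].
have h (s t : R) : 0 <= s ^+ 2 * bform A w w + 2 * s * t * bform A w v
    + t ^+ 2 * bform A v v.
  have := pA (s *: w + t *: v); rewrite -/(bform _ _ _).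
  rewrite !bformDl !bformDr !bformZl !bformZr (bformC v w sA) => h.
  by apply: le_trans h _; rewrite le_eqVlt; apply/orP; left; apply/eqP; ring.
have a0 : 0 <= bform A w w := pA w.
have c0 : 0 <= bform A v v := pA v.
set a := bform A w w in h a0 *; set b := bform A w v in h *; set c := bform A v v in h c0 *.
(* If c = 0 the form is affine in t, and for b != 0 the chosen t makes it -1. Otherwise s = c, t =
   -b turns it into c (a c - b^2). *)
have [cz|cnz] := eqVneq c 0.
  rewrite cz mulr0; rewrite cz in h.
  have [->|b0] := eqVneq b 0; first by rewrite expr0n.
  have := h 1 (- (a + 1) / (2 * b)).
  rewrite (_ : 2 * 1 * _ * b = - (a + 1)); last by field.
  by lra.
have c1 : 0 < c by rewrite lt_def cnz.
have := h c (- b).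
rewrite (_ : _ + _ = c * (a * c - b ^+ 2)); last by ring.
by rewrite pmulr_rge0// subr_ge0.
Qed.

(** Cauchy-Schwarz against w = A v. At a touching time this upgrades a degenerate direction to the
    vector equation X v = r Lam v. *)
Lemma nnd_mul_eq0 {R : realType} {n : nat} (A : 'M[R]_n) v :
  nnd A -> bform A v v = 0 -> A *m v = 0.
Proof.
move=> nA v0; apply: sqn_eq0.
have := nnd_CauchySchwarz (A *m v) v nA; rewrite v0 mulr0.
rewrite {1}/bform -mulmxA => h; apply/eqP; rewrite -sqrf_eq0 eq_le sqr_ge0 andbT.
by rewrite {1}/bform mulmx1.
Qed.

Lemma pd_nnd {R : realType} {n : nat} (A : 'M[R]_n) : pd A -> nnd A.
Proof.
move=> [sA pA]; split=> // v; have [->|/pA/ltW//] := eqVneq v 0.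
by rewrite mulmx0 mxE.
Qed.

(** Cauchy-Schwarz for A^-1 v and v reads |v|^4 <= (v^T A^-1 v) (v^T A v), so an upper bound K for
    the form of A^-1 gives the constant 1/K. *)
Lemma nnd_unit_coercive {R : realType} {n : nat} (A : 'M[R]_n) :
  nnd A -> A \in unitmx -> exists2 c, 0 < c & forall v, c * sqn v <= bform A v v.
Proof.
move=> nA uA; have [K K0 hK] := bform_bound (invmx A).
exists K^-1; first by rewrite invr_gt0.
move=> v; have [-> |/sqn_gt0 v0] := eqVneq v 0.
  by rewrite /bform !mulmx0 mxE mulr0.
have := nnd_CauchySchwarz (invmx A *m v) v nA; have [sA _] := nA.
have -> : bform A (invmx A *m v) v = sqn v.
  by rewrite /bform trmx_mul trmx_inv sA mulmxKV// mulmx1.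
have -> : bform A (invmx A *m v) (invmx A *m v) = bform (invmx A) v v.
  by rewrite /bform trmx_mul trmx_inv sA mulmxKV// mulmxA.
have A0 : 0 <= bform A v v by case: nA => _; apply.
have := hK v; rewrite ler_norml => /andP[_ h1] h2.
rewrite mulrC ler_pdivrMr// mulrC.
have : sqn v ^+ 2 <= K * sqn v * bform A v v.
  by apply: le_trans h2 _; rewrite ler_wpM2r.
by rewrite mulrAC expr2 ler_pM2r.
Qed.

Lemma singular_left_kernel {R : realType} {n : nat} (A : 'M[R]_n) :
  A \notin unitmx -> exists2 u : 'rV_n, u != 0 & u *m A = 0.
Proof.
rewrite -row_free_unit -kermx_eq0 => /rowV0Pn[u /sub_kermxP uA u0].
by exists u.
Qed.

Lemma pd_unitmx {R : realType} {n : nat} (A : 'M[R]_n) : pd A -> A \in unitmx.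
Proof.
move=> pA; apply/negPn/negP => /singular_left_kernel[u u0 uA].
have [_ /(_ u^T)] := pA; rewrite trmxK uA mul0mx mxE ltxx => h.
suff : false by []; apply: h; apply: contra u0 => /eqP e.
by rewrite -[u]trmxK e trmx0.
Qed.

Lemma pd_coercive {R : realType} {n : nat} (A : 'M[R]_n) :
  pd A -> exists2 c, 0 < c & forall v, c * sqn v <= bform A v v.
Proof.
by move=> pA; apply: nnd_unit_coercive; [exact: pd_nnd|exact: pd_unitmx].
Qed.

Lemma eigenvalue_bform {R : realType} {n : nat} (A : 'M[R]_n) a :
  eigenvalue A a -> exists2 v : 'cV_n, v != 0 & bform A v v = a * sqn v.
Proof.
move=> /eigenvalueP[u uA u0]; exists u^T.
  by apply: contra u0 => /eqP e; rewrite -[u]trmxK e trmx0.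
by rewrite /bform trmxK uA mulmx1 -scalemxAl mxE.
Qed.

(* The supremum m of all m with m |v|^2 <= v^T A v is an eigenvalue: otherwise
   A - m would be invertible, hence coercive, and m could be increased. *)
Lemma min_eig_le_bform {R : realType} {n : nat} (A : 'M[R]_n) a v :
  symmx A -> is_min_eig A a -> a * sqn v <= bform A v v.
Proof.
move=> sA [ea mina].
pose E := [set m : R | forall v, m * sqn v <= bform A v v].
have [w w0 wA] := eigenvalue_bform ea.
have E0 : has_sup E.
  split.
    have [K K0 hK] := bform_bound A; exists (- K) => u.
    by have := hK u; rewrite ler_norml mulNr => /andP[].
  by exists a => m /(_ w); rewrite wA ler_pM2r// sqn_gt0.
have Em : E (sup E).
  move=> u; have [->|/sqn_gt0 u0] := eqVneq u 0.
    by rewrite /bform !mulmx0 mxE mulr0.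
  rewrite -ler_pdivlMr//; apply: ge_sup; first by case: E0.
  by move=> m Em; rewrite ler_pdivlMr//; exact: Em.
have nB : nnd (A - (sup E)%:M).
  split; first by rewrite /symmx linearB /= tr_scalar_mx sA.
  by move=> u; rewrite -/(bform _ u u) bform_sub bform_scalar subr_ge0; exact: Em.
have : A - (sup E)%:M \notin unitmx.
  apply/negP => /(nnd_unit_coercive nB)[c c0 hc].
  suff : sup E + c <= sup E by lra.
  apply: ub_le_sup; first by case: E0.
  by move=> u; have := hc u; rewrite bform_sub bform_scalar; lra.
move=> /singular_left_kernel[u u0 uA].
have /mina am : eigenvalue A (sup E).
  apply/eigenvalueP; exists u => //; apply/eqP.
  by rewrite -subr_eq0 -mul_mx_scalar -mulmxBr uA.
by apply: le_trans (Em v); rewrite ler_wpM2r// sqn_ge0.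
Qed.

Lemma bform_le_max_eig {R : realType} {n : nat} (A : 'M[R]_n) a v :
  symmx A -> is_max_eig A a -> bform A v v <= a * sqn v.
Proof.
move=> sA [ea maxa]; rewrite -lerN2 -mulNr -bform_opp.
have eN b : eigenvalue (- A) b -> eigenvalue A (- b).
  move=> /eigenvalueP[u uA u0]; apply/eigenvalueP; exists u => //.
  by rewrite scaleNr -uA mulmxN opprK.
apply: min_eig_le_bform; first by rewrite /symmx linearN /= sA.
split; last by move=> b /eN/maxa; rewrite lerNl.
have /eigenvalueP[u uA u0] := ea.
by apply/eigenvalueP; exists u => //; rewrite mulmxN uA scaleNr.
Qed.

Lemma nnd_eigenvalue_ge0 {R : realType} {n : nat} (A : 'M[R]_n) a :
  nnd A -> eigenvalue A a -> 0 <= a.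
Proof.
move=> [_ nA] /eigenvalue_bform[v /sqn_gt0 v0 e].
by have := nA v; rewrite -/(bform A v v) e pmulr_lge0.
Qed.

Lemma pd_eigenvalue_gt0 {R : realType} {n : nat} (A : 'M[R]_n) a :
  pd A -> eigenvalue A a -> 0 < a.
Proof.
move=> [_ nA] /eigenvalue_bform[v v0 e].
by have := nA v v0; rewrite -/(bform A v v) e pmulr_lgt0 ?sqn_gt0.
Qed.

(** * First touch *)

Lemma is_derive_fsum {R : realType} {n : nat} (h : 'I_n -> R -> R) (x : R)
    (dh : 'I_n -> R) : (forall i, is_derive x 1 (h i) (dh i)) ->
  is_derive x 1 (fun y => \sum_i h i y) (\sum_i dh i).
Proof.
move=> hd; rewrite (_ : (fun y => _) = \sum_i h i); last first.
  by apply/funext => y; rewrite fct_sumE.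
exact: is_derive_sum.
Qed.

Lemma is_derive_bform {R : realType} {n : nat} (X : R -> 'M[R]_n) (t : R) D w v :
  entry_derive X t D ->
  is_derive t 1 (fun s => bform (X s) w v) (bform D w v).
Proof.
move=> hX; rewrite (_ : (fun s => _) =
    fun s => \sum_i \sum_j (w i 0 * v j 0) * X s i j); last first.
  apply/funext => s; rewrite bformE; apply: eq_bigr => i _; apply: eq_bigr => j _.
  by rewrite mulrAC.
rewrite bformE; apply: is_derive_fsum => i; apply: is_derive_fsum => j.
by rewrite mulrAC; exact: is_derive_mull.
Qed.

Lemma is_derive_lt0_right {R : realType} (f : R -> R) (x d : R) :
  is_derive x 1 f d -> d < 0 ->
  exists2 e, 0 < e & forall y, x < y < x + e -> f y < f x.
Proof.
move=> [hd hv] d0.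
have /cvgrPdist_lt : (fun h => h^-1 *: ((f \o shift x) (h *: (1 : R)) - f x)) @ 0^' --> d.
  by rewrite -hv; exact: hd.
have dN : 0 < - d by rewrite oppr_gt0.
move=> /(_ _ dN) /nbhs_ballP[e /= e0 he]; exists e => // y /andP[xy ye].
have := he (y - x); rewrite /ball /= sub0r normrN gtr0_norm ?subr_gt0// => h.
have := h _ _; rewrite subr_eq0 gt_eqF// /GRing.scale /= mulr1 subrK.
have -> : y - x < e by lra.
move=> /(_ isT isT); rewrite ltr_norml => /andP[h1 _].
have h2 : (y - x)^-1 * (f y - f x) < 0 by lra.
by move: h2; rewrite pmulr_rlt0 ?invr_gt0 ?subr_gt0// subr_lt0.
Qed.

(** Coercivity with constant c survives an entrywise change of c / (2 (n^2 + 1)), which alters the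
    form by at most (c/2) |v|^2. The neighbourhood is thus uniform in v. *)
Lemma near_pd {R : realType} {n : nat} (X : R -> 'M[R]_n) (t : R) :
  (forall i j, {for t, continuous (fun s => X s i j)}) -> pd (X t) ->
  \forall s \near t, forall v, v != 0 -> 0 < bform (X s) v v.
Proof.
move=> cX /pd_coercive[c c0 hc].
have e0 : 0 < c / (2 * ((n * n)%:R + 1)).
  by rewrite divr_gt0// mulr_gt0// ltr_wpDl.
have := near_mx_close cX e0; apply: filterS => s hs v /sqn_gt0 v0.
have h := @bform_entry_bound _ _ (X t - X s) (c / (2 * ((n * n)%:R + 1))) v.
have {}h : `|bform (X t - X s) v v| <= c / 2 * sqn v.
  apply: le_trans (h _) _; first by move=> i j; rewrite !mxE; exact: hs.
  rewrite ler_pM2r// mulrA ler_pdivrMr; last by rewrite mulr_gt0// ltr_wpDl.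
  set N : R := (n * n)%:R; have N0 : 0 <= N by [].
  by nra.
have := hc v; move: h; rewrite bform_sub ler_norml => /andP[_].
have : 0 < c * sqn v by rewrite mulr_gt0.
lra.
Qed.

(* At the largest time t1 at which some [H b] is not positive definite, [H b t1]
   is still nonnegative and degenerate in some direction v, where the sign of the
   derivative contradicts [v^T (H b) v > 0] on the right of t1. *)
Lemma pd_of_first_touch {R : realType} {n : nat} (H dH : bool -> R -> 'M[R]_n)
    (t0 T : R) :
  (forall b t, t0 <= t <= T -> symmx (H b t)) ->
  (forall b t, t0 <= t <= T -> entry_derive (H b) t (dH b t)) ->
  (forall b, pd (H b T)) ->
  (forall t, t0 <= t < T -> (forall b, nnd (H b t)) ->
     forall b v, v != 0 -> bform (H b t) v v = 0 -> bform (dH b t) v v < 0) ->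
  forall b t, t0 <= t <= T -> pd (H b t).
Proof.
move=> sH dH' pT hneg b0 t00 t00i; apply: contrapT => npd.
have cH b t : t0 <= t <= T -> forall i j, {for t, continuous (fun s => H b s i j)}.
  by move=> ti i j; exact: is_derive_continuous (dH' b t ti i j).
pose A := [set t | t0 <= t <= T /\ exists b, ~ pd (H b t)].
have A0 : has_sup A.
  by split; [exists t00; split=> //; exists b0|exists T => t [/andP[]]].
pose t1 := sup A.
have At1 t : A t -> t <= t1 by apply: ub_le_sup; case: A0.
have t1i : t0 <= t1 <= T.
  apply/andP; split.
    by apply: le_trans (At1 t00 _); [case/andP: t00i|split=> //; exists b0].
  by apply: ge_sup; [case: A0|move=> t [/andP[]]].
have pdright t b : t1 < t <= T -> pd (H b t).
  move=> /andP[t1t tT]; apply: contrapT => h.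
  suff /At1 : A t by lra.
  by split; [lra|exists b].
(* The supremum is attained: if both forms were positive definite at t1, they would remain so near
   t1, where there are points of [A]. *)
have t1notpd : exists b, ~ pd (H b t1).
  apply: contrapT => hn.
  have hp b : pd (H b t1) by apply: contrapT => h; apply: hn; exists b.
  have h b := near_pd (cH b t1 t1i) (hp b).
  pose P b := [set s | forall v, v != 0 -> 0 < bform (H b s) v v].
  have : nbhs t1 (P true `&` P false) by apply: filterI; exact: h.
  move=> /nbhs_ballP[e /= e0 he].
  have [t At tl] := sup_adherent e0 A0.
  have [ti [b nb]] := At; apply: nb.
  have tb : ball t1 e t.
    have := At1 t At; rewrite -/t1 in tl; rewrite /ball /= => h'.
    by rewrite ger0_norm ?subr_ge0//; lra.
  split; first exact: sH.
  by have [ht hf] := he t tb; case: b.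
have t1T : t1 < T.
  have [b nb] := t1notpd; rewrite lt_neqAle; case/andP: t1i => _ ->; rewrite andbT.
  by apply: contra_notN nb => /eqP ->.
have dq b v : is_derive t1 1 (fun s => bform (H b s) v v) (bform (dH b t1) v v).
  exact/is_derive_bform/dH'.
(* By continuity, a negative value at t1 would persist to the right of t1, where both forms are
   positive definite. *)
have nn b : nnd (H b t1).
  split; first exact: sH.
  move=> v; rewrite -/(bform _ _ _) leNgt; apply/negP => neg.
  have v0 : v != 0.
    by apply: contraTN neg => /eqP ->; rewrite /bform mulmx0 mxE ltxx.
  have /cvgrPdist_lt := is_derive_continuous (dq b v).
  have nn' : 0 < - bform (H b t1) v v by rewrite oppr_gt0.
  move=> /(_ _ nn') /nbhs_ballP[e /= e0 he].
  pose s := Num.min T (t1 + e / 2).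
  have s1 : t1 < s <= T.
    by rewrite /s lt_min t1T ge_min lexx /= andbT; lra.
  have s2 : s <= t1 + e / 2 by rewrite /s ge_min lexx orbT.
  have := he s; rewrite /ball /= ltr0_norm; last by lra.
  have -> : - (t1 - s) < e by lra.
  move=> /(_ isT); rewrite ltr_norml => /andP[h _].
  have [_ /(_ v v0)] := pdright s b s1; rewrite -/(bform _ _ _); lra.
have [b nb] := t1notpd.
have [v v0 vb] : exists2 v, v != 0 & bform (H b t1) v v <= 0.
  apply: contrapT => h; apply: nb; split; first exact: sH.
  move=> v v0; rewrite -/(bform _ _ _) ltNge; apply/negP => hv; apply: h.
  by exists v.
have vz : bform (H b t1) v v = 0.
  by apply/eqP; rewrite eq_le vb /=; have [_] := nn b; apply.
have t1i' : t0 <= t1 < T by rewrite t1T andbT; case/andP: t1i.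
have [e e0 he] := is_derive_lt0_right (dq b v) (hneg t1 t1i' nn b v v0 vz).
pose s := Num.min T (t1 + e / 2).
have s1 : t1 < s <= T.
  by rewrite /s lt_min t1T ge_min lexx /= andbT; lra.
have s2 : s <= t1 + e / 2 by rewrite /s ge_min lexx orbT.
have := he s; rewrite vz.
have -> : t1 < s < t1 + e by lra.
move=> /(_ isT).
have [_ /(_ v v0)] := pdright s b s1; rewrite -/(bform _ _ _); lra.
Qed.

(** * Scalar Riccati equations and uniqueness *)

(* The substitution p = r1 + 1 / w turns the equation into w' = -1 - (r1 - r2) w. *)
Lemma exists_scalar_riccati {R : realType} (r1 r2 p0 T : R) :
  r2 <= r1 -> r1 < p0 ->
  exists p : R -> R, p T = p0 /\ forall t : R, t <= T ->
    is_derive t 1 p ((p t - r1) * (p t - r2)) /\ r1 < p t.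
Proof.
move=> r21 r1p; pose d := r1 - r2; pose w0 := (p0 - r1)^-1.
have w00 : 0 < w0 by rewrite invr_gt0 subr_gt0.
suff [w [wT [dw wpos]]] : exists w : R -> R, w T = w0 /\
    (forall t : R, is_derive t 1 w (- 1 - d * w t)) /\ forall t, t <= T -> 0 < w t.
  exists (fun t => r1 + (w t)^-1); split; first by rewrite wT invrK; lra.
  move=> t tT; have w1 := wpos t tT; have wn : w t != 0 by rewrite gt_eqF.
  split; last by rewrite ltrDl invr_gt0.
  have := is_deriveD (is_derive_cst r1 t (1 : R)) (is_deriveV wn (dw t)).
  move=> h; apply: is_derive_eq h _; rewrite add0r /GRing.scale /= /d.
  by field.
have [d0|dn] := eqVneq d 0.
  exists (fun t => w0 + (T - t)); split; first by lra.
  split=> [t|t tT]; last by lra.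
  have := is_deriveD (is_derive_cst w0 t (1 : R))
    (is_deriveB (is_derive_cst T t (1 : R)) (is_derive_id t (1 : R))).
  by move=> h; apply: is_derive_eq h _; rewrite d0; ring.
have dp : 0 < d by rewrite lt_def dn subr_ge0.
have di : 0 < d^-1 by rewrite invr_gt0.
exists (fun t => (w0 + d^-1) * expR (- d * (t - T)) - d^-1); split.
  by rewrite subrr mulr0 expR0; lra.
split=> [t|t tT].
  have := is_deriveB (is_derive_mull (w0 + d^-1) (is_derive_expR_affine (- d) T t))
    (is_derive_cst d^-1 t (1 : R)).
  by move=> h; apply: is_derive_eq h _; field.
(* Hence w >= w0 on the left of T: p exists on the whole half-line and stays above r1. *)
have : 1 <= expR (- d * (t - T)).
  by rewrite -expR0 ler_expR; nra.
nra.
Qed.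

Lemma within_continuous_sum {R : realType} (A : set R) {n : nat}
    (f : 'I_n -> R -> R) :
  (forall i, {within A, continuous (f i)}) ->
  {within A, continuous (fun s => \sum_i f i s)}.
Proof.
move=> cf; rewrite (_ : (fun s => _) = \sum_i f i); last first.
  by apply/funext => y; rewrite fct_sumE.
elim/big_ind : _ => [|g h cg ch|i _]; last exact: cf.
- by move=> x; exact: cvg_cst.
- by move=> x; apply: cvgD; [exact: cg|exact: ch].
Qed.

Lemma within_continuous_bounded {R : realType} (f : R -> R) (a b : R) :
  a <= b -> {within `[a, b], continuous f} ->
  exists M, forall t, a <= t <= b -> `|f t| <= M.
Proof.
move=> ab cf; have [c _ hc] := EVT_max ab cf; have [d _ hd] := EVT_min ab cf.
exists (`|f c| + `|f d|) => t tab.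
have ti : t \in `[a, b]%R by rewrite in_itv.
have := hc t ti; have := hd t ti; rewrite ler_norml.
have := ler_norm (f c); have := ler_norm (- f d); rewrite normrN.
have := normr_ge0 (f c); have := normr_ge0 (f d); lra.
Qed.

Lemma finite_uniform_bound {R : realType} {I : finType} (P : I -> R -> Prop) :
  (forall i x y, x <= y -> P i x -> P i y) ->
  (forall i, exists M, P i M) -> exists2 M, 0 < M & forall i, P i M.
Proof.
move=> mono H; have [M hM] := choice H.
exists (1 + \sum_i `|M i|); first by rewrite ltr_pwDl// sumr_ge0.
move=> i; apply: mono (hM i); rewrite (bigD1 i)//=.
have : 0 <= \sum_(j | j != i) `|M j| by rewrite sumr_ge0.
have := ler_norm (M i); lra.
Qed.

(** Differentiability is asked only inside the interval, so that half-line solutions and solutions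
    that extend past T both restrict to it. *)
Definition mx_ivp_on {R : realType} {n : nat} (F : 'M[R]_n -> 'M[R]_n) (t0 T : R)
    (X0 : 'M[R]_n) (X : R -> 'M[R]_n) :=
  [/\ X T = X0, forall t, t0 < t < T -> entry_derive X t (F (X t)) &
    forall i j, {within `[t0, T], continuous (fun s => X s i j)}].

Lemma mx_ivp_sol_on {R : realType} {n : nat} F (t0 T : R) (X0 : 'M[R]_n) X :
  mx_ivp_sol F T X0 X -> mx_ivp_on F t0 T X0 X.
Proof.
move=> [XT [dX cX]]; split=> // [t /andP[_ tT] i j|i j]; first exact: dX.
apply: continuous_subspaceW (cX i j) => s /=.
by rewrite in_itv/= => /andP[].
Qed.

(* Gronwall: for K large, the squared distance times exp(K s) is nondecreasing. *)
Lemma mx_ivp_on_unique {R : realType} {n : nat} F (T t0 L : R) (X0 : 'M[R]_n) X Y :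
  mx_ivp_on F t0 T X0 X -> mx_ivp_on F t0 T X0 Y -> t0 <= T ->
  (forall t e : R, t0 <= t <= T -> 0 <= e -> mx_close (X t) (Y t) e ->
     mx_close (F (X t)) (F (Y t)) (L * e)) ->
  X t0 = Y t0.
Proof.
move=> [XT dX cX] [YT dY cY] t0T hL.
pose D s i j := X s i j - Y s i j.
pose dD s i j := F (X s) i j - F (Y s) i j.
pose phi s := \sum_i \sum_j D s i j * D s i j.
pose dphi s := \sum_i \sum_j (dD s i j * D s i j + D s i j * dD s i j).
(* Each of the n^2 summands of phi' is at least -2 L phi. *)
pose K := 2 * L * (n * n)%:R.
pose psi s := phi s * expR (K * (s - T)).
pose dpsi s := dphi s * expR (K * (s - T)) + phi s * (K * expR (K * (s - T))).
have Dle s i j : `|D s i j| <= Num.sqrt (phi s).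
  rewrite -sqrtr_sqr ler_wsqrtr// /phi (bigD1 i)//= (bigD1 j)//= -addrA -expr2 lerDl.
  by rewrite addr_ge0// sumr_ge0// => k _; rewrite -?expr2 ?sqr_ge0// sumr_ge0// => m _;
    rewrite -expr2 sqr_ge0.
have phi0 s : 0 <= phi s.
  by rewrite sumr_ge0// => i _; rewrite sumr_ge0// => j _; rewrite -expr2 sqr_ge0.
have cD i j : {within `[t0, T], continuous (fun s => D s i j)}.
  by have h1 := cX i j; have h2 := cY i j; move=> x; apply: cvgB; [exact: h1|exact: h2].
have cpsi : {within `[t0, T], continuous psi}.
  move=> x; apply: cvgM; last first.
    apply: (@continuous_subspaceT _ _ `[t0, T] (fun s => expR (K * (s - T)))) => s.
    exact: is_derive_continuous (is_derive_expR_affine K T s).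
  move: x; apply: within_continuous_sum => i; apply: within_continuous_sum => j x.
  by apply: cvgM; exact: cD.
have dpsi' x : t0 < x < T -> is_derive x 1 psi (dpsi x).
  move=> xi; apply: is_derive_mul; last exact: is_derive_expR_affine.
  apply: is_derive_fsum => i; apply: is_derive_fsum => j.
  by apply: is_derive_mul; apply: is_deriveB; [exact: dX|exact: dY|exact: dX|exact: dY].
have hpos x : t0 < x < T -> 0 <= dpsi x.
  move=> /andP[/ltW t0x /ltW xT]; rewrite /dpsi mulrCA mulrA -mulrDl.
  rewrite mulr_ge0 ?expR_ge0// -lerBlDr sub0r.
  set e := Num.sqrt (phi x).
  have e0 : 0 <= e by exact: sqrtr_ge0.
  have e2 : phi x = e * e by rewrite -expr2 sqr_sqrtr.
  have hdD i j : `|dD x i j| <= L * e.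
    by apply: hL => //; [rewrite t0x xT|exact: Dle].
  have -> : - (K * phi x) = \sum_(i < n) \sum_(j < n) (- (2 * L * phi x)).
    by rewrite !sumr_const !card_ord -mulrnA mulNrn -mulr_natl /K; ring.
  apply: ler_sum => i _; apply: ler_sum => j _.
  have h : `|dD x i j * D x i j| <= L * e * e.
    by rewrite normrM ler_pM//; exact: Dle.
  by move: h; rewrite ler_norml e2; lra.
have := le_of_is_derive t0T cpsi dpsi' hpos.
have -> : psi T = 0.
  rewrite /psi /phi big1 ?mul0r// => i _; rewrite big1// => j _.
  by rewrite /D XT YT subrr mul0r.
rewrite /psi pmulr_lle0 ?expR_gt0// => h.
have {}h : phi t0 = 0 by apply/eqP; rewrite eq_le h phi0.
apply/matrixP => i j; apply/eqP; rewrite -subr_eq0 -normr_le0.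
by have := Dle t0 i j; rewrite h sqrtr0.
Qed.

(** * Bounded Lipschitz functions of a matrix *)

(** Boundedness is part of the notion because it makes the class stable under products. *)
Definition bounded_lipschitz {R : realType} {n : nat} (K : set 'M[R]_n)
    (f : 'M[R]_n -> R) :=
  exists C : R, [/\ 0 <= C, forall A, K A -> `|f A| <= C &
    forall A B e, K A -> K B -> 0 <= e -> mx_close A B e -> `|f A - f B| <= C * e].

Definition mx_bounded_lipschitz {R : realType} {n : nat} (K : set 'M[R]_n)
    (F : 'M[R]_n -> 'M[R]_n) :=
  forall i j, bounded_lipschitz K (fun A => F A i j).

Lemma bounded_lipschitz_cst {R : realType} {n : nat} (K : set 'M[R]_n) (c : R) :
  bounded_lipschitz K (fun=> c).
Proof.
exists `|c|; split=> // A B e _ _ e0 _.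
by rewrite subrr normr0 mulr_ge0.
Qed.

Lemma bounded_lipschitz_add {R : realType} {n : nat} (K : set 'M[R]_n) f g :
  bounded_lipschitz K f -> bounded_lipschitz K g ->
  bounded_lipschitz K (fun A => f A + g A).
Proof.
move=> [C [C0 bf lf]] [D [D0 bg lg]]; exists (C + D); split.
- exact: addr_ge0.
- by move=> A KA; apply: le_trans (ler_normD _ _) _; rewrite lerD ?bf ?bg.
- move=> A B e KA KB e0 AB; rewrite opprD addrACA mulrDl.
  by apply: le_trans (ler_normD _ _) _; rewrite lerD ?lf ?lg.
Qed.

Lemma bounded_lipschitz_mul {R : realType} {n : nat} (K : set 'M[R]_n) f g :
  bounded_lipschitz K f -> bounded_lipschitz K g ->
  bounded_lipschitz K (fun A => f A * g A).
Proof.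
move=> [C [C0 bf lf]] [D [D0 bg lg]]; exists (2 * (C * D)); split.
- by rewrite mulr_ge0// mulr_ge0.
- move=> A KA; rewrite normrM.
  have : `|f A| * `|g A| <= C * D by rewrite ler_pM ?bf ?bg.
  have : 0 <= C * D by exact: mulr_ge0.
  lra.
- move=> A B e KA KB e0 AB.
  have -> : f A * g A - f B * g B = f A * (g A - g B) + (f A - f B) * g B by ring.
  apply: le_trans (ler_normD _ _) _; rewrite !normrM.
  have : `|f A| * `|g A - g B| <= C * (D * e) by rewrite ler_pM ?bf ?lg.
  have : `|f A - f B| * `|g B| <= C * e * D by rewrite ler_pM ?bg ?lf.
  lra.
Qed.

Lemma bounded_lipschitz_sum {R : realType} {n : nat} (K : set 'M[R]_n)
    {I : finType} (f : I -> 'M[R]_n -> R) :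
  (forall i, bounded_lipschitz K (f i)) ->
  bounded_lipschitz K (fun A => \sum_i f i A).
Proof.
move=> hf; rewrite (_ : (fun A => _) = \sum_i f i); last first.
  by apply/funext => A; rewrite fct_sumE.
elim/big_ind : _ => [|g h|i _]; last exact: hf.
- exact: bounded_lipschitz_cst.
- exact: bounded_lipschitz_add.
Qed.

(** From 1/a - 1/b = - (a - b) / (a b). The estimate is algebraic rather than a mean value argument,
    so f may take both signs on K. *)
Lemma bounded_lipschitz_inv {R : realType} {n : nat} (K : set 'M[R]_n)
    (f : 'M[R]_n -> R) (N : R) :
  (forall A, K A -> f A != 0 /\ `|(f A)^-1| <= N) -> bounded_lipschitz K f ->
  bounded_lipschitz K (fun A => (f A)^-1).
Proof.
move=> hN [C [C0 bf lf]]; exists (`|N| + N ^+ 2 * C); split.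
- by rewrite addr_ge0// mulr_ge0// sqr_ge0.
- move=> A /hN[_ h]; apply: le_trans h _; apply: le_trans (ler_norm _) _.
  by rewrite lerDl mulr_ge0// sqr_ge0.
- move=> A B e KA KB e0 AB.
  have [a0 hA] := hN A KA; have [b0 hB] := hN B KB.
  have -> : (f A)^-1 - (f B)^-1 = - ((f A)^-1 * (f B)^-1 * (f A - f B)).
    by field; rewrite a0 b0.
  rewrite normrN !normrM.
  have N1 : `|(f A)^-1| * `|(f B)^-1| <= N ^+ 2 by rewrite expr2 ler_pM.
  have : `|(f A)^-1| * `|(f B)^-1| * `|f A - f B| <= N ^+ 2 * (C * e).
    by apply: ler_pM => //; exact: lf.
  have : 0 <= `|N| * e by rewrite mulr_ge0.
  lra.
Qed.

Lemma mx_bounded_lipschitz_id {R : realType} {n : nat} (K : set 'M[R]_n) (M : R) :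
  (forall A, K A -> forall i j, `|A i j| <= M) -> mx_bounded_lipschitz K id.
Proof.
move=> hM i j; exists (`|M| + 1); split; first by rewrite addr_ge0.
- move=> A KA; apply: le_trans (hM A KA i j) _.
  by have := ler_norm M; lra.
- move=> A B e _ _ e0 AB; apply: le_trans (AB i j) _.
  by rewrite mulrDl mul1r lerDr mulr_ge0.
Qed.

Lemma mx_bounded_lipschitz_cst {R : realType} {n : nat} (K : set 'M[R]_n) (B : 'M[R]_n) :
  mx_bounded_lipschitz K (fun=> B).
Proof. by move=> i j; exact: bounded_lipschitz_cst. Qed.

Lemma mx_bounded_lipschitz_tr {R : realType} {n : nat} (K : set 'M[R]_n) F :
  mx_bounded_lipschitz K F -> mx_bounded_lipschitz K (fun A => (F A)^T).
Proof.
move=> hF i j; rewrite (_ : (fun A => _) = fun A => F A j i)//.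
by apply/funext => A; rewrite mxE.
Qed.

Lemma mx_bounded_lipschitz_add {R : realType} {n : nat} (K : set 'M[R]_n) F G :
  mx_bounded_lipschitz K F -> mx_bounded_lipschitz K G ->
  mx_bounded_lipschitz K (fun A => F A + G A).
Proof.
move=> hF hG i j; rewrite (_ : (fun A => _) = fun A => F A i j + G A i j).
  exact: bounded_lipschitz_add.
by apply/funext => A; rewrite mxE.
Qed.

Lemma mx_bounded_lipschitz_mul {R : realType} {n : nat} (K : set 'M[R]_n) F G :
  mx_bounded_lipschitz K F -> mx_bounded_lipschitz K G ->
  mx_bounded_lipschitz K (fun A => F A *m G A).
Proof.
move=> hF hG i j; rewrite (_ : (fun A => _) = fun A => \sum_k F A i k * G A k j).
  by apply: bounded_lipschitz_sum => k; exact: bounded_lipschitz_mul.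
by apply/funext => A; rewrite mxE.
Qed.

Lemma mx_bounded_lipschitz_riccati {R : realType} {n : nat}
    (Lam Sig : 'M[R]_n) (alpha : R) (theta : 'I_n -> R) (K : set 'M[R]_n) (M N : R) :
  (forall A, K A -> forall i j, `|A i j| <= M) ->
  (forall A, K A -> forall i, A i i != 0 /\ `|(A i i)^-1| <= N) ->
  mx_bounded_lipschitz K (riccati_rhs Lam Sig alpha theta).
Proof.
move=> hM hN; have idK := mx_bounded_lipschitz_id hM.
have trK := mx_bounded_lipschitz_tr idK.
apply: mx_bounded_lipschitz_add; last exact: mx_bounded_lipschitz_cst.
apply: mx_bounded_lipschitz_add; apply: mx_bounded_lipschitz_mul => //;
  apply: mx_bounded_lipschitz_mul => //; first exact: mx_bounded_lipschitz_cst.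
move=> i j.
rewrite (_ : (fun A => _) = fun A : 'M[R]_n => (i == j)%:R * theta i * (A i i)^-1).
  apply: bounded_lipschitz_mul; first exact: bounded_lipschitz_cst.
  by apply: (bounded_lipschitz_inv (N := N)); [move=> A KA; exact: hN|exact: idK].
apply/funext => A; rewrite !mxE; case: eqP => [->|_]; last by rewrite !mul0r.
by rewrite mul1r.
Qed.

Lemma mx_bounded_lipschitz_quadratic {R : realType} {n : nat} (th : R) (B : 'M[R]_n)
    (K : set 'M[R]_n) (M : R) :
  (forall A, K A -> forall i j, `|A i j| <= M) ->
  mx_bounded_lipschitz K (fun X => X *m X + th *: X - B).
Proof.
move=> hM; have idK := mx_bounded_lipschitz_id hM.
apply: mx_bounded_lipschitz_add; last exact: mx_bounded_lipschitz_cst.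
apply: mx_bounded_lipschitz_add; first exact: mx_bounded_lipschitz_mul.
have h : mx_bounded_lipschitz K (fun A => th%:M *m A).
  by apply: mx_bounded_lipschitz_mul => //; exact: mx_bounded_lipschitz_cst.
suff e : (fun A : 'M[R]_n => th%:M *m A) = (fun A => th *: A) by rewrite e in h.
by apply/funext => A; rewrite mul_scalar_mx.
Qed.

Lemma mx_bounded_lipschitz_uniform {R : realType} {n : nat} (K : set 'M[R]_n) F :
  mx_bounded_lipschitz K F ->
  exists2 C : R, 0 < C & (forall A, K A -> forall i j, `|F A i j| <= C) /\
    (forall A B e, K A -> K B -> mx_close A B e -> mx_close (F A) (F B) (C * e)).
Proof.
move=> hF.
have [] := @finite_uniform_bound R ('I_n * 'I_n)%type (fun ij C =>
  (forall A, K A -> `|F A ij.1 ij.2| <= C) /\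
  (forall A B e, K A -> K B -> 0 <= e -> mx_close A B e ->
     `|F A ij.1 ij.2 - F B ij.1 ij.2| <= C * e)).
- move=> ij x y xy [h1 h2]; split=> [A KA|A B e KA KB e0 AB].
    exact: le_trans (h1 A KA) _.
  by apply: le_trans (h2 A B e KA KB e0 AB) _; rewrite ler_wpM2r.
- by move=> [i j]; have [C [_ h1 h2]] := hF i j; exists C.
move=> C C0 hC; exists C => //; split=> [A KA i j|A B e KA KB AB i j].
  by have [h _] := hC (i, j); exact: h.
have [_ h] := hC (i, j); apply: h => //; exact: le_trans (AB i j).
Qed.

Lemma mx_ivp_on_unique_in {R : realType} {n : nat} (K : set 'M[R]_n) F (t0 T : R)
    (X0 : 'M[R]_n) X Y :
  mx_ivp_on F t0 T X0 X -> mx_ivp_on F t0 T X0 Y -> mx_bounded_lipschitz K F ->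
  t0 <= T -> (forall t, t0 <= t <= T -> K (X t) /\ K (Y t)) -> X t0 = Y t0.
Proof.
move=> hX hY /mx_bounded_lipschitz_uniform[C C0 [_ hC]] t0T hK.
apply: (mx_ivp_on_unique (L := C) hX hY t0T) => t e ti e0 XY.
by have [KX KY] := hK t ti; exact: hC.
Qed.

Lemma mx_ivp_on_bounded {R : realType} {n : nat} F (t0 T : R) (X0 : 'M[R]_n) X :
  mx_ivp_on F t0 T X0 X -> t0 <= T ->
  exists M, forall t, t0 <= t <= T -> forall i j, `|X t i j| <= M.
Proof.
move=> [_ _ cX] t0T.
have [] := @finite_uniform_bound R ('I_n * 'I_n)%type (fun ij C =>
  forall t, t0 <= t <= T -> `|X t ij.1 ij.2| <= C).
- by move=> ij x y xy h t ti; exact: le_trans (h t ti) xy.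
- move=> ij; apply: (within_continuous_bounded (f := fun s => X s ij.1 ij.2)) => //.
by move=> M _ hM; exists M => t ti i j; exact: (hM (i, j)).
Qed.

(** On the compact [t, T] both solutions are bounded, and the right-hand side is Lipschitz on
    bounded sets. This identifies arbitrary matrix solutions P and Q with p I and q I. *)
Lemma quadratic_ivp_unique {R : realType} {n : nat} (th : R) (B : 'M[R]_n) (T t : R)
    (X0 : 'M[R]_n) X Y :
  mx_ivp_sol (fun X => X *m X + th *: X - B) T X0 X ->
  mx_ivp_sol (fun X => X *m X + th *: X - B) T X0 Y -> t <= T -> X t = Y t.
Proof.
move=> /(mx_ivp_sol_on t) hX /(mx_ivp_sol_on t) hY tT.
have [M hM] := mx_ivp_on_bounded hX tT; have [N hN] := mx_ivp_on_bounded hY tT.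
pose K := [set A : 'M[R]_n | forall i j, `|A i j| <= Num.max M N].
apply: (mx_ivp_on_unique_in (K := K) hX hY) => //.
  by apply: mx_bounded_lipschitz_quadratic => A; exact.
by move=> s si; split=> i j; rewrite le_max ?hM ?hN ?orbT.
Qed.

(** A competing solution is only known to have a nonvanishing diagonal. By compactness of [t, T] its
    entries and the inverses of its diagonal entries are bounded there, which suffices for a
    Lipschitz estimate. *)
Lemma riccati_ivp_unique {R : realType} {n : nat} (Lam Sig : 'M[R]_n) (alpha : R)
    (theta : 'I_n -> R) (t T : R) (X0 : 'M[R]_n) X Y :
  mx_ivp_on (riccati_rhs Lam Sig alpha theta) t T X0 X ->
  mx_ivp_on (riccati_rhs Lam Sig alpha theta) t T X0 Y ->
  (forall s, t <= s <= T -> forall i, X s i i != 0) ->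
  (forall s, t <= s <= T -> forall i, Y s i i != 0) ->
  t <= T -> X t = Y t.
Proof.
move=> hX hY nX nY tT.
have [M hM] := mx_ivp_on_bounded hX tT; have [N hN] := mx_ivp_on_bounded hY tT.
have H Z : mx_ivp_on (riccati_rhs Lam Sig alpha theta) t T X0 Z ->
    (forall s, t <= s <= T -> forall i, Z s i i != 0) ->
    exists2 N, 0 < N & forall i s, t <= s <= T -> `|(Z s i i)^-1| <= N.
  move=> [_ _ cZ] nZ.
  apply: (finite_uniform_bound (P := fun i N => forall s, t <= s <= T -> `|(Z s i i)^-1| <= N)).
    by move=> i x y xy h s si; exact: le_trans (h s si) xy.
  move=> i; apply: (within_continuous_bounded (f := fun s => (Z s i i)^-1)) => //.
  apply/subspace_continuousP => s; rewrite /= in_itv/= => ts.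
  apply: cvgV; first exact: nZ.
  by have /subspace_continuousP := cZ i i; apply; rewrite /= in_itv/=.
have [N1 _ h1] := H X hX nX; have [N2 _ h2] := H Y hY nY.
pose K := [set A : 'M[R]_n | (forall i j, `|A i j| <= Num.max M N) /\
  forall i, A i i != 0 /\ `|(A i i)^-1| <= Num.max N1 N2].
apply: (mx_ivp_on_unique_in (K := K) hX hY) => //.
  by apply: (@mx_bounded_lipschitz_riccati _ _ _ _ _ _ K (Num.max M N) (Num.max N1 N2))
    => A [].
move=> s si.
by split; split=> [i j|i]; rewrite ?le_max ?hM ?hN ?orbT// ?nX ?nY ?h1 ?h2 ?orbT.
Qed.

(** * The truncated equation *)

Lemma riccati_rhs_sym {R : realType} {n : nat} (Lam Sig : 'M[R]_n) (alpha : R)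
    (theta : 'I_n -> R) (X : 'M[R]_n) : symmx Lam -> symmx Sig ->
  symmx (riccati_rhs Lam Sig alpha theta X).
Proof.
move=> sL sS; rewrite /symmx /riccati_rhs !linearB /= !linearD /= linearZ /=.
by rewrite !trmx_mul trmx_inv sL sS tr_diag_mx trmxK !mulmxA.
Qed.

Lemma bform_riccati_rhs {R : realType} {n : nat} (Lam Sig : 'M[R]_n) (alpha : R)
    (theta : 'I_n -> R) (X : 'M[R]_n) v :
  bform (riccati_rhs Lam Sig alpha theta X) v v =
  bform (invmx Lam) (X *m v) (X *m v)
  + \sum_i theta i / X i i * (X *m v) i 0 ^+ 2 - alpha * bform Sig v v.
Proof.
rewrite /riccati_rhs bform_sub bform_add !bform_mul bform_scale; congr (_ + _ - _).
rewrite bformE; apply: eq_bigr => i _; rewrite (bigD1 i)//= big1 ?addr0.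
  by rewrite !mxE eqxx mulr1n expr2; ring.
by move=> j ji; rewrite !mxE eq_sym (negbTE ji) mulr0n mulr0 mul0r.
Qed.

Lemma diag_term_ge0 {R : realType} {n : nat} (theta : 'I_n -> R) (X : 'M[R]_n)
    (v : 'cV[R]_n) :
  (forall i, 0 <= theta i) -> (forall i, 0 < X i i) ->
  0 <= \sum_i theta i / X i i * (X *m v) i 0 ^+ 2.
Proof.
move=> th0 X0; apply: sumr_ge0 => i _; rewrite mulr_ge0 ?sqr_ge0//.
by rewrite divr_ge0// ltW.
Qed.

(* Cauchy-Schwarz for the form X gives (X v)_i^2 <= X_ii v^T X v. *)
Lemma diag_term_le {R : realType} {n : nat} (theta : 'I_n -> R) (X : 'M[R]_n)
    (v : 'cV[R]_n) :
  (forall i, 0 <= theta i) -> (forall i, 0 < X i i) -> nnd X ->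
  \sum_i theta i / X i i * (X *m v) i 0 ^+ 2 <= (\sum_i theta i) * bform X v v.
Proof.
move=> th0 X0 nX; rewrite mulr_suml; apply: ler_sum => i _.
have := nnd_CauchySchwarz (delta_mx i 0) v nX.
rewrite bform_delta bform_delta2 => h.
rewrite -mulrA ler_wpM2l// mulrC ler_pdivrMr//.
by rewrite mulrC.
Qed.

Lemma nnd_diag_ge0 {R : realType} {n : nat} (X : 'M[R]_n) i : nnd X -> 0 <= X i i.
Proof.
by move=> [_ nX]; rewrite -bform_delta2; exact: nX.
Qed.

(** Turns matrix barriers into membership in a box: the diagonal is compared with that of Lam, and
    the 2 x 2 minors control the other entries. *)
Lemma loewner_bounds_entries {R : realType} {n : nat} (Lam X : 'M[R]_n) (r s : R) :
  pd Lam -> symmx X -> 0 < r -> nnd (X - r *: Lam) -> nnd (s *: Lam - X) ->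
  [/\ nnd X, forall i, r * Lam i i <= X i i, forall i, X i i <= s * Lam i i &
      forall i j, X i j ^+ 2 <= X i i * X j j].
Proof.
move=> pL sX r0 h1 h2.
have nX : nnd X.
  split=> // v; have [_ /(_ v)] := h1; rewrite -!/(bform _ _ _) bform_sub bform_scale.
  have : 0 <= bform Lam v v by have [_] := pd_nnd pL; apply.
  nra.
split=> //.
- by move=> i; have := nnd_diag_ge0 i h1; rewrite !mxE subr_ge0.
- by move=> i; have := nnd_diag_ge0 i h2; rewrite !mxE subr_ge0.
- move=> i j; have := nnd_CauchySchwarz (delta_mx i 0) (delta_mx j 0) nX.
  by rewrite !bform_delta2.
Qed.

Lemma bform_invmx_mul {R : realType} {n : nat} (Lam : 'M[R]_n) v :
  symmx Lam -> Lam \in unitmx ->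
  bform (invmx Lam) (Lam *m v) (Lam *m v) = bform Lam v v.
Proof. by move=> sL uL; rewrite /bform trmx_mul sL mulmxK// mulmxA. Qed.

Definition clamp {R : realType} (a b x : R) := Num.max a (Num.min b x).

Lemma clamp_dist {R : realType} (a b x y : R) : `|clamp a b x - clamp a b y| <= `|x - y|.
Proof.
wlog xy : x y / y <= x => [H|].
  have [|/ltW] := leP y x; first exact: H.
  by move=> xy; rewrite distrC [leRHS]distrC; exact: H.
rewrite (ger0_norm (_ : 0 <= x - y)) ?subr_ge0// ler_norml /clamp.
by case: (leP b x) => ?; case: (leP b y) => ?; case: (leP a b) => ?;
  case: (leP a x) => ?; case: (leP a y) => ?; lra.
Qed.

Lemma clamp_id {R : realType} (a b x : R) : a <= x <= b -> clamp a b x = x.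
Proof. by move=> /andP[ax xb]; rewrite /clamp min_r// max_r. Qed.

Lemma clamp_ge {R : realType} (a b x : R) : a <= clamp a b x.
Proof. by rewrite /clamp le_max lexx. Qed.

Lemma clamp_le {R : realType} (a b x : R) : clamp a b x <= Num.max a b.
Proof.
rewrite /clamp; case: (leP b x) => ?; case: (leP a b) => ?; case: (leP a x) => ?; lra.
Qed.

(** The diagonal gets the positive lower end d to keep theta_i / c_ii bounded. For d > M a clamped
    diagonal entry equals d, whence [Num.max d M] in the bounds. *)
Definition clampmx {R : realType} {n : nat} (d M : R) (A : 'M[R]_n) : 'M[R]_n :=
  \matrix_(i, j) clamp (if i == j then d else - M) M (A i j).

Lemma clampmx_close {R : realType} {n : nat} (d M e : R) (A B : 'M[R]_n) :
  mx_close A B e -> mx_close (clampmx d M A) (clampmx d M B) e.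
Proof.
by move=> AB i j; rewrite !mxE; apply: le_trans (clamp_dist _ _ _ _) (AB i j).
Qed.

Lemma clampmx_id {R : realType} {n : nat} (d M : R) (A : 'M[R]_n) :
  (forall i j, `|A i j| <= M) -> (forall i, d <= A i i) -> clampmx d M A = A.
Proof.
move=> hM hd; apply/matrixP => i j; rewrite mxE clamp_id//.
have := hM i j; rewrite ler_norml => /andP[h1 ->]; rewrite andbT.
by case: eqP => [->|_].
Qed.

Lemma clampmx_norm {R : realType} {n : nat} (d M : R) (A : 'M[R]_n) i j :
  0 < d -> 0 < M -> `|clampmx d M A i j| <= Num.max d M.
Proof.
move=> d0 M0; rewrite mxE ler_norml.
have h := clamp_ge (if i == j then d else - M) M (A i j).
have h' := clamp_le (if i == j then d else - M) M (A i j).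
apply/andP; split.
  apply: le_trans h; case: ifP => _; rewrite ?lerN2 ?le_max ?lexx ?orbT//.
  by rewrite (@le_trans _ _ 0)// ?ltW// oppr_lt0 lt_max d0.
apply: le_trans h' _; rewrite ge_max; case: ifP => _; rewrite !le_max !lexx ?orbT//= andbT.
by apply/orP; right; lra.
Qed.

Lemma exists_truncated_solution {R : realType} {n : nat} (Lam Sig : 'M[R]_n)
    (alpha : R) (theta : 'I_n -> R) (T d M : R) (X0 : 'M[R]_n) : 0 < d -> 0 < M ->
  exists X : R -> 'M[R]_n, X T = X0 /\ forall t,
    entry_derive X t (riccati_rhs Lam Sig alpha theta (clampmx d M (X t))).
Proof.
move=> d0 M0; set F := riccati_rhs _ _ _ _.
pose K := [set A : 'M[R]_n | (forall i j, `|A i j| <= Num.max d M) /\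
  forall i, A i i != 0 /\ `|(A i i)^-1| <= d^-1].
have Kc A : K (clampmx d M A).
  split=> [i j|i]; first exact: clampmx_norm.
  have h : d <= clampmx d M A i i by rewrite mxE eqxx clamp_ge.
  have h0 := lt_le_trans d0 h.
  by rewrite gt_eqF// gtr0_norm ?invr_gt0// lef_pV2.
have : mx_bounded_lipschitz K F.
  by apply: (@mx_bounded_lipschitz_riccati _ _ _ _ _ _ K (Num.max d M) d^-1) => A [].
move=> /mx_bounded_lipschitz_uniform[C C0 [hC lC]].
apply: (@picard_lindelof _ _ (F \o clampmx d M) C C T X0) => //.
- by move=> A i j; exact: hC.
- by move=> A B e AB; apply: lC => //; exact: clampmx_close.
Qed.

(** Mirror entries have the same derivative and agree at T. Here F is a function of time: the
    truncated right-hand side evaluated along X. *)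
Lemma solution_sym {R : realType} {n : nat} (F : R -> 'M[R]_n) (T t : R)
    (X : R -> 'M[R]_n) : symmx (X T) -> (forall s, symmx (F s)) ->
  (forall s, entry_derive X s (F s)) -> symmx (X t).
Proof.
move=> sT sF dX; apply/matrixP => i j; rewrite mxE.
pose a := Num.min t T - 1; pose b := Num.max t T + 1.
have e : X t j i - X T j i = X t i j - X T i j.
  apply: (@eq_of_is_derive _ (fun s => X s j i) (fun s => X s i j) (fun s => F s i j) a b).
  - by move=> s _; rewrite -(sF s) mxE; exact: dX.
  - by move=> s _; exact: dX.
  - by rewrite /a /b; case: (leP t T) => ?; lra.
  - by rewrite /a /b; case: (leP t T) => ?; lra.
have : X T j i = X T i j by rewrite -{1}sT mxE.
by move: e; lra.
Qed.

(** * Barriers *)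

Lemma entry_derive_sub {R : realType} {n : nat} (X Y : R -> 'M[R]_n) (t : R) D E :
  entry_derive X t D -> entry_derive Y t E ->
  entry_derive (fun s => X s - Y s) t (D - E).
Proof.
move=> hX hY i j; rewrite [X in is_derive _ _ _ X]mxE [X in is_derive _ _ _ (_ + X)]mxE.
rewrite (_ : (fun s => _) = fun s => X s i j - Y s i j); last first.
  by apply/funext => s; rewrite !mxE.
by apply: is_deriveB; [exact: hX|exact: hY].
Qed.

Lemma entry_derive_scale {R : realType} {n : nat} (f : R -> R) (t df : R) (A : 'M[R]_n) :
  is_derive t 1 f df -> entry_derive (fun s => f s *: A) t (df *: A).
Proof.
move=> hf i j; rewrite mxE mulrC.
rewrite (_ : (fun s => _) = fun s => A i j * f s); last first.
  by apply/funext => s; rewrite !mxE mulrC.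
exact: is_derive_mull.
Qed.

(** The eigenvalue data enter as inequalities between forms relative to Lam, so the square root S
    does not appear. The bounds by p(t0) and q(T), supplied later by monotonicity, fix the box. *)
Lemma exists_riccati_solution_between {R : realType} {n : nat} (Lam Sig : 'M[R]_n)
    (alpha : R) (theta : 'I_n -> R) (T l t0 dmin dmax : R) (p q : R -> R) :
  let th := \sum_i theta i in
  pd Lam -> symmx Sig -> 0 <= alpha -> (forall i, 0 <= theta i) ->
  (forall v, dmin * bform Lam v v <= bform Sig v v) ->
  (forall v, bform Sig v v <= dmax * bform Lam v v) ->
  (forall t : R, t <= T -> is_derive t 1 p (p t ^+ 2 + th * p t - alpha * dmin)) ->
  (forall t : R, t <= T -> is_derive t 1 q (q t ^+ 2 - alpha * dmax)) ->
  t0 <= T -> 0 < p t0 -> (forall t, t0 <= t <= T -> p t0 <= p t) ->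
  (forall t, t0 <= t <= T -> 0 <= q t <= q T) ->
  (forall v, p T * bform Lam v v <= l * sqn v) ->
  (forall v, l * sqn v <= q T * bform Lam v v) ->
  exists X : R -> 'M[R]_n, X T = l%:M /\ forall t, t0 <= t <= T ->
    [/\ entry_derive X t (riccati_rhs Lam Sig alpha theta (X t)), symmx (X t),
        forall i, 0 < X t i i, nnd (X t - p t *: Lam) & nnd (q t *: Lam - X t)].
Proof.
move=> th pL sS a0 th0 hmin hmax dp dq t0T p0 pm qm pT qT.
have [sL L0] := pL; have uL := pd_unitmx pL.
have [c c0 hc] := pd_coercive pL; have [K K0 hK] := bform_bound Lam.
(* The largest shift used: for e <= e0 the lower barrier p - e stays above p(t0)/2 > 0 on
   [t0, T]. *)
pose e0 := p t0 / 2; have e00 : 0 < e0 by rewrite divr_gt0.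
have qT0 : 0 <= q T by have := qm T; rewrite t0T lexx => /(_ isT) /andP[].
(* Between the shifted barriers a diagonal entry lies between e0 Lam_ii and (q(T) + e0) Lam_ii,
   while c <= Lam_ii <= K. *)
pose d := e0 * c; pose M := (q T + e0) * K.
have d0 : 0 < d by rewrite mulr_gt0.
have M0 : 0 < M by rewrite mulr_gt0// ltr_wpDl.
have th_ge0 : 0 <= th by exact: sumr_ge0.
have [X [XT dX]] := exists_truncated_solution Lam Sig alpha theta T l%:M d0 M0.
have sX t : symmx (X t).
  apply: (solution_sym (T := T) t _ _ dX); first by rewrite XT /symmx tr_scalar_mx.
  by move=> s; exact: riccati_rhs_sym.
have Ldiag i : c <= Lam i i <= K.
  have := hc (delta_mx i 0); have := hK (delta_mx i 0); rewrite !bform_delta2 mxE eqxx !mulr1.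
  by rewrite ler_norml => /andP[_ ->] ->.
(* Where both shifted barriers hold weakly the truncation is inactive, so at a touching time the
   true right-hand side is available. *)
have inbox t e : t0 <= t <= T -> 0 < e <= e0 ->
    nnd (X t - (p t - e) *: Lam) -> nnd ((q t + e) *: Lam - X t) ->
    [/\ clampmx d M (X t) = X t, nnd (X t) & forall i, 0 < X t i i].
  move=> ti /andP[e1 e2] h1 h2.
  have r0 : e0 <= p t - e by have := pm t ti; rewrite /e0 in e2 *; lra.
  have s0 : q t + e <= q T + e0 by have := qm t ti; lra.
  have [nX lo hi off] := loewner_bounds_entries pL (sX t) (lt_le_trans e00 r0) h1 h2.
  have Xlo i : d <= X t i i.
    apply: le_trans (lo i); have /andP[h _] := Ldiag i.
    by apply: ler_pM => //; exact: ltW.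
  have Xhi i : X t i i <= M.
    apply: le_trans (hi i) _; have /andP[h h'] := Ldiag i.
    apply: ler_pM => //; last exact: ltW (lt_le_trans c0 h).
    by have := qm t ti; lra.
  split=> //; last by move=> i; exact: lt_le_trans (Xlo i).
  apply: clampmx_id => // i j.
  rewrite -sqrtr_sqr -[leRHS](ger0_norm (ltW M0)) -(sqrtr_sqr M) ler_wsqrtr//.
  apply: le_trans (off i j) _; rewrite expr2; apply: ler_pM => //;
    exact: ltW (lt_le_trans d0 (Xlo _)).
pose H e (b : bool) t := if b then X t - (p t - e) *: Lam else (q t + e) *: Lam - X t.
pose F t := riccati_rhs Lam Sig alpha theta (clampmx d M (X t)).
pose dH (b : bool) t := if b then F t - (p t ^+ 2 + th * p t - alpha * dmin) *: Lam
  else (q t ^+ 2 - alpha * dmax) *: Lam - F t.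
have pdH e b t : 0 < e <= e0 -> t0 <= t <= T -> pd (H e b t).
  move=> ei; have /andP[e1 e2] := ei.
  apply: (@pd_of_first_touch _ _ (H e) dH).
  - move=> [] s _; rewrite /symmx /H /= linearB /= linearZ /= sL; congr (_ - _); exact: sX.
  - move=> [] s /andP[_ sT].
      apply: entry_derive_sub; first exact: dX.
      apply: entry_derive_scale; rewrite -[X in is_derive _ _ _ X]subr0.
      by apply: is_deriveB; exact: dp.
    apply: entry_derive_sub; last exact: dX.
    apply: entry_derive_scale; rewrite -[X in is_derive _ _ _ X]addr0.
    by apply: is_deriveD; exact: dq.
  - move=> b'; split.
      by rewrite /symmx /H XT; case: b'; rewrite linearB /= linearZ /= tr_scalar_mx sL.
    move=> v v0; rewrite -/(bform _ _ _) /H XT; case: b';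
      rewrite bform_sub bform_scale bform_scalar.
      by have := pT v; have := L0 v v0; rewrite -/(bform _ _ _); nra.
    by have := qT v; have := L0 v v0; rewrite -/(bform _ _ _); nra.
  - move=> s /andP[t0s sT] hn b' v v0 vz.
    have si : t0 <= s <= T by rewrite t0s ltW.
    have [cX nX dX0] := inbox s e si ei (hn true) (hn false).
    have LV := L0 v v0; rewrite -/(bform _ _ _) in LV.
    have := nnd_mul_eq0 (hn b') vz.
    rewrite /dH /F cX.
    have smin : alpha * (dmin * bform Lam v v) <= alpha * bform Sig v v.
      exact: ler_wpM2l.
    have smax : alpha * bform Sig v v <= alpha * (dmax * bform Lam v v).
      exact: ler_wpM2l.
    have ps := pm s si; have qs := qm s si.
    case: b' vz; rewrite /H /= mulmxBl -scalemxAl bform_sub bform_scale => vz /eqP;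
      rewrite subr_eq0 => /eqP Xv.
      rewrite bform_sub bform_scale bform_riccati_rhs.
      have := diag_term_le v th0 dX0 nX; rewrite -/th.
      set D := \sum_i _.
      rewrite Xv bformZl bformZr bform_invmx_mul//.
      have -> : bform (X s) v v = (p s - e) * bform Lam v v by lra.
      move=> hD.
      (* With r = p - e, the derivative of the form is at most (r^2 + th r - p^2 - th p) v^T Lam v,
         and the bracket is - e (2 p - e + th). *)
      have : 0 < e * (2 * p s - e + th) * bform Lam v v.
        by rewrite !mulr_gt0//; rewrite /e0 in e2; lra.
      by lra.
    rewrite bform_sub bform_scale bform_riccati_rhs.
    have := diag_term_ge0 v th0 dX0; set D := \sum_i _.
    rewrite -Xv bformZl bformZr bform_invmx_mul// => hD.
    (* Here the bracket is q^2 - (q + e)^2 = - e (2 q + e). *)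
    have : 0 < e * (2 * q s + e) * bform Lam v v.
      by rewrite !mulr_gt0//; lra.
    by lra.
exists X; split=> // t ti.
have e0i : 0 < e0 <= e0 by rewrite e00 lexx.
have [cX nX X0] := inbox t e0 ti e0i (pd_nnd (pdH e0 true t e0i ti))
  (pd_nnd (pdH e0 false t e0i ti)).
(* The truncation, hence X, does not depend on the shift; so the shift e0 / 2^k can tend to 0 for
   this one X. *)
have ek k : 0 < e0 * 2^-1 ^+ k <= e0.
  rewrite mulr_gt0 ?exprn_gt0//= ler_piMr//; first exact: ltW.
  by apply: exprn_ile1; lra.
split=> //; first by move: (dX t); rewrite cX.
- split; first by rewrite /symmx linearB /= linearZ /= sL sX.
  move=> v; rewrite -/(bform _ _ _) bform_sub bform_scale subr_ge0.
  apply: (@le_of_geometric _ _ _ (e0 * bform Lam v v)) => k.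
  have [_ /(_ v)] := pd_nnd (pdH _ true t (ek k) ti).
  by rewrite -/(bform _ _ _) /H bform_sub bform_scale; lra.
- split; first by rewrite /symmx linearB /= linearZ /= sL sX.
  move=> v; rewrite -/(bform _ _ _) bform_sub bform_scale subr_ge0.
  apply: (@le_of_geometric _ _ _ (e0 * bform Lam v v)) => k.
  have [_ /(_ v)] := pd_nnd (pdH _ false t (ek k) ti).
  by rewrite -/(bform _ _ _) /H bform_sub bform_scale; lra.
Qed.

(** * Gluing and conjugation *)

Lemma scalar_quadratic_sol {R : realType} {n : nat} (th c T : R) (p : R -> R) :
  (forall t : R, t <= T -> is_derive t 1 p (p t ^+ 2 + th * p t - c)) ->
  mx_ivp_sol (fun X : 'M[R]_n => X *m X + th *: X - c%:M) T (p T)%:M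
    (fun t => (p t)%:M).
Proof.
move=> dp.
have dP t : t <= T -> entry_derive (fun t => (p t)%:M) t
    ((p t)%:M *m (p t)%:M + th *: (p t)%:M - c%:M : 'M[R]_n).
  move=> tT.
  rewrite (_ : _ - _ = (p t ^+ 2 + th * p t - c) *: (1%:M : 'M[R]_n)); last first.
    by rewrite scalemx1 raddfB raddfD /= expr2 scalar_mxM scale_scalar_mx.
  rewrite (_ : (fun t => _) = fun t => p t *: (1%:M : 'M[R]_n)); last first.
    by apply/funext => s; rewrite scalemx1.
  exact/entry_derive_scale/dp.
split=> //; split=> [t tT i j|i j]; first exact: (dP t (ltW tT)).
apply: continuous_in_subspaceT => t; rewrite inE /= => tT.
exact: is_derive_continuous (dP t tT i j).
Qed.

Lemma nnd_conj {R : realType} {n : nat} (S A : 'M[R]_n) :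
  symmx S -> nnd A -> nnd (S *m A *m S).
Proof.
move=> sS [sA nA]; split; first by rewrite /symmx !trmx_mul sS sA mulmxA.
by move=> v; rewrite -/(bform _ _ _) -{1}sS bform_mul; exact: nA.
Qed.

(** Above the larger root r1 both factors are positive. On [t0, T] the minimum of p is thus p(t0)
    and the maximum of q is q(T). *)
Lemma le_of_riccati {R : realType} (r1 r2 T a b : R) (p : R -> R) : r2 <= r1 ->
  (forall t : R, t <= T -> is_derive t 1 p ((p t - r1) * (p t - r2)) /\ r1 < p t) ->
  a <= b <= T -> p a <= p b.
Proof.
move=> r21 hp /andP[ab bT].
apply: (le_of_is_derive (df := fun t => (p t - r1) * (p t - r2)) ab).
- apply: (is_derive_within_continuous (df := fun t => (p t - r1) * (p t - r2))) => x.
  by move=> /andP[_ xb]; have [] := hp x (le_trans xb bT).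
- by move=> x /andP[_ /ltW xb]; have [] := hp x (le_trans xb bT).
- move=> x /andP[_ /ltW xb]; have [_ h] := hp x (le_trans xb bT).
  by rewrite mulr_ge0//; lra.
Qed.

(** The value at t comes from the solution [Y t], which reaches back to t - 1, so that near t the
    glued function coincides with [Y t]. Past T it continues as [Y T], which gives a two-sided
    derivative at T as well. *)
Lemma glue_solutions {R : realType} {n : nat} (F : 'M[R]_n -> 'M[R]_n) (T : R)
    (Y : R -> R -> 'M[R]_n) :
  (forall a t, a <= T -> a - 1 <= t <= T -> entry_derive (Y a) t (F (Y a t))) ->
  (forall a b, a <= T -> b <= T -> a - 1 <= b -> Y a b = Y b b) ->
  mx_ivp_sol F T (Y T T) (fun t => Y (Num.min t T) t).
Proof.
move=> dY YE.
have dC t : t <= T -> entry_derive (fun t => Y (Num.min t T) t) t (F (Y t t)).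
  move=> tT i j.
  apply: (@near_eq_is_derive _ _ _ (fun s => Y t s i j)); last first.
    by apply: dY => //; lra.
  have n1 : \forall s \near t, `|t - s| < 1 by apply: nbhsx_ballx.
  have [tlt|tge] := ltP t T.
    have d0 : 0 < T - t by lra.
    have n2 : \forall s \near t, `|t - s| < T - t by exact: (@nbhsx_ballx R R t _ d0).
    near=> s.
    have h1 : `|t - s| < 1 by near: s.
    have h2 : `|t - s| < T - t by near: s.
    move: h1 h2; rewrite !ltr_norml => h1 h2.
    rewrite min_l; last by lra.
    by rewrite YE//; lra.
  have -> : t = T by apply/eqP; rewrite eq_le tT.
  near=> s.
  have [sT|sT //] := leP s T.
  have : `|T - s| < 1.
    by near: s; apply: nbhsx_ballx.
  by rewrite ltr_norml => h1; rewrite YE//; lra.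
split; first by rewrite minxx.
split=> [t tT i j|i j].
  by have := dC t (ltW tT) i j; rewrite min_l ?ltW.
apply: continuous_in_subspaceT => t; rewrite inE /= => tT.
exact: is_derive_continuous (dC t tT i j).
Unshelve. all: by end_near.
Qed.

Lemma sqrt_congruence {R : realType} {n : nat} (Lam S : 'M[R]_n) :
  Lam \in unitmx -> S *m S = invmx Lam -> S *m Lam *m S = 1%:M.
Proof.
move=> uL SS; apply: mulmx1C.
by rewrite mulmxA SS mulVmx.
Qed.

(* With v = S w, the form of Sig at v is that of S Sig S at w, and v^T Lam v = |w|^2. *)
Lemma bform_congruence {R : realType} {n : nat} (Lam Sig S : 'M[R]_n) v :
  symmx S -> S *m Lam *m S = 1%:M ->
  exists w, bform Sig v v = bform (S *m Sig *m S) w w /\ bform Lam v v = sqn w.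
Proof.
move=> sS h; exists (Lam *m S *m v).
have e A w : bform (S *m A *m S) w w = bform A (S *m w) (S *m w).
  by rewrite -{1}sS bform_mul.
by rewrite -h !e !mulmxA h mul1mx.
Qed.

Theorem theorem3p2 (R : realType) (n : nat) (T alpha l : R)
  (Lam Sig S : 'M[R]_n) (theta : 'I_n -> R)
  (dmin dmax lmin lmax : R) :
  (0 < n)%N -> 0 < T -> 0 <= alpha ->
  pd Lam -> nnd Sig -> (forall i, 0 <= theta i) ->
  (* S = sqrt(Lam^-1), the symmetric positive definite square root *)
  pd S -> S *m S = invmx Lam ->
  is_min_eig (S *m Sig *m S) dmin -> is_max_eig (S *m Sig *m S) dmax ->
  is_min_eig Lam lmin -> is_max_eig Lam lmax ->
  let th := \sum_i theta i in
  Num.max (lmax * (Num.sqrt (th ^+ 2 / 4 + alpha * dmin) - th / 2))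
          (lmin * Num.sqrt (alpha * dmax)) < l ->
  (exists C : R -> 'M[R]_n,
      main_sol Lam Sig alpha theta T l C /\
      (forall C' : R -> 'M[R]_n, main_sol Lam Sig alpha theta T l C' ->
         forall t, t <= T -> C' t = C t) /\
      (forall t, t <= T -> symmx (C t)) /\
      (exists P : R -> 'M[R]_n,
         mx_ivp_sol (fun X => X *m X + th *: X - (alpha * dmin)%:M) T
           ((l / lmax)%:M) P) /\
      (exists Q : R -> 'M[R]_n,
         mx_ivp_sol (fun X => X *m X - (alpha * dmax)%:M) T
           ((l / lmin)%:M) Q) /\
      (forall P Q : R -> 'M[R]_n,
         mx_ivp_sol (fun X => X *m X + th *: X - (alpha * dmin)%:M) T
           ((l / lmax)%:M) P ->
         mx_ivp_sol (fun X => X *m X - (alpha * dmax)%:M) T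
           ((l / lmin)%:M) Q ->
         forall t, t <= T ->
           pd (P t) /\
           loewner_le (P t) (S *m C t *m S) /\
           loewner_le (S *m C t *m S) (Q t))).
Proof.
move=> _ _ a0 pL nS th0 pS SS hdmin hdmax hlmin hlmax th.
rewrite gt_max => /andP[hl1 hl2].
have [sL L0] := pL; have [sS _] := pS; have [sSig _] := nS.
have SLS := sqrt_congruence (pd_unitmx pL) SS.
have nD := nnd_conj sS nS; have [sD _] := nD.
have lmin0 : 0 < lmin := pd_eigenvalue_gt0 pL hlmin.1.
have lmax0 : 0 < lmax := pd_eigenvalue_gt0 pL hlmax.1.
have dmin0 : 0 <= dmin := nnd_eigenvalue_ge0 nD hdmin.1.
have th_ge0 : 0 <= th by exact: sumr_ge0.
have Smin v : dmin * bform Lam v v <= bform Sig v v.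
  have [w [-> ->]] := bform_congruence Sig v sS SLS.
  exact: min_eig_le_bform.
have Smax v : bform Sig v v <= dmax * bform Lam v v.
  have [w [-> ->]] := bform_congruence Sig v sS SLS.
  exact: bform_le_max_eig.
have l0 : 0 < l by apply: le_lt_trans hl2; rewrite mulr_ge0 ?sqrtr_ge0// ltW.
(* The roots of the two scalar right-hand sides are sp - th/2, -sp - th/2 and sq, -sq. The two parts
   of l > l0 say that l/lmax and l/lmin exceed the larger ones. *)
pose sp := Num.sqrt (th ^+ 2 / 4 + alpha * dmin).
pose sq := Num.sqrt (alpha * dmax).
have dmax0 : 0 <= dmax := nnd_eigenvalue_ge0 nD hdmax.1.
have ad0 : 0 <= alpha * dmin by exact: mulr_ge0.
have sp2 : sp ^+ 2 = th ^+ 2 / 4 + alpha * dmin.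
  by rewrite sqr_sqrtr// addr_ge0// divr_ge0// sqr_ge0.
have sq2 : sq ^+ 2 = alpha * dmax by rewrite sqr_sqrtr// mulr_ge0.
have sp0 : 0 <= sp by exact: sqrtr_ge0.
have sq0 : 0 <= sq by exact: sqrtr_ge0.
(* As alpha dmin >= 0, the larger root sp - th/2 is nonnegative; this is the source of P > 0. *)
have spth : th / 2 <= sp by nra.
have p21 : - sp - th / 2 <= sp - th / 2 by lra.
have p10 : sp - th / 2 < l / lmax by rewrite ltr_pdivlMr// mulrC.
have q21 : - sq <= sq by lra.
have q10 : sq < l / lmin by rewrite ltr_pdivlMr// mulrC.
have [p [pT hp]] := exists_scalar_riccati T p21 p10.
have [q [qT hq]] := exists_scalar_riccati T q21 q10.
have dp t : t <= T -> is_derive t 1 p (p t ^+ 2 + th * p t - alpha * dmin).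
  move=> /hp[h _]; apply: is_derive_eq h _.
  have -> : alpha * dmin = sp ^+ 2 - th ^+ 2 / 4 by lra.
  by field.
have dq t : t <= T -> is_derive t 1 q (q t ^+ 2 - alpha * dmax).
  by move=> /hq[h _]; apply: is_derive_eq h _; rewrite -sq2; ring.
have p0 t : t <= T -> 0 < p t by move=> /hp[_]; lra.
have q0 t : t <= T -> 0 <= q t by move=> /hq[_]; lra.
have pTle v : p T * bform Lam v v <= l * sqn v.
  have := bform_le_max_eig v sL hlmax; rewrite pT mulrAC ler_pdivrMr// => h.
  by rewrite -mulrA ler_pM2l// mulrC.
have qTge v : l * sqn v <= q T * bform Lam v v.
  have := min_eig_le_bform v sL hlmin; rewrite qT mulrAC ler_pdivlMr// => h.
  by rewrite -mulrA ler_pM2l// mulrC.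
pose F := riccati_rhs Lam Sig alpha theta.
(* Starting at a - 1 leaves room to the left of a for the gluing. For a > T any function serves as a
   dummy. *)
have HY a : exists X : R -> 'M[R]_n, a <= T -> X T = l%:M /\
    forall t, a - 1 <= t <= T -> [/\ entry_derive X t (F (X t)), symmx (X t),
      forall i, 0 < X t i i, nnd (X t - p t *: Lam) & nnd (q t *: Lam - X t)].
  have [aT|aT] := leP a T; last by exists (fun=> 0).
  have a1 : a - 1 <= T by lra.
  have [|||X hX] := exists_riccati_solution_between pL sSig a0 th0 Smin Smax dp dq a1 _ _ _ pTle qTge.
  - exact: p0.
  - by move=> t ti; exact: (le_of_riccati p21 hp).
  - move=> t /andP[_ tT]; rewrite q0//=.
    by apply: (le_of_riccati q21 hq); rewrite tT lexx.
  by exists X.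
have [Y hY] := choice HY.
have Yon a b : a <= T -> a - 1 <= b -> mx_ivp_on F b T l%:M (Y a).
  move=> aT ab; have [YT hYa] := hY a aT.
  split=> // [t ti|i j].
    by have [|//] := hYa t; lra.
  apply: (is_derive_within_continuous (df := fun t => F (Y a t) i j)) => x xi.
  have xi' : a - 1 <= x <= T by lra.
  by have [h _ _ _ _] := hYa x xi'; exact: h.
have Ynz a b : a <= T -> a - 1 <= b -> forall s, b <= s <= T -> forall i, Y a s i i != 0.
  move=> aT ab s si i; have [_ hYa] := hY a aT.
  have si' : a - 1 <= s <= T by lra.
  by have [_ _ h _ _] := hYa s si'; rewrite gt_eqF.
have Yeq a b : a <= T -> b <= T -> a - 1 <= b -> Y a b = Y b b.
  move=> aT bT ab; have b1 : b - 1 <= b by lra.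
  apply: (riccati_ivp_unique (Yon a b aT ab) (Yon b b bT b1)) => //.
  - exact: Ynz.
  - exact: Ynz.
have := @glue_solutions _ _ F T Y.
set C := fun t => Y (Num.min t T) t.
have CE t : t <= T -> C t = Y t t by move=> tT; rewrite /C min_l.
have hC t : t <= T -> [/\ symmx (C t), forall i, 0 < C t i i,
    nnd (C t - p t *: Lam) & nnd (q t *: Lam - C t)].
  move=> tT; rewrite CE//; have [_ h] := hY t tT.
  by have [|_ ? ? ? ?] := h t; [lra|split].
have [YTT _] := hY T (lexx T).
rewrite YTT => /(_ _ Yeq) solC.
have {}solC : mx_ivp_sol F T l%:M C.
  apply: solC => a t aT ti; have [_ h] := hY a aT.
  by have [] := h t ti.
have mC : main_sol Lam Sig alpha theta T l C.
  by split=> // t /hC[_ h _ _] i; rewrite gt_eqF.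
(* The equation for Q is the case th = 0 of the one for P. *)
have QE : (fun X : 'M[R]_n => X *m X - (alpha * dmax)%:M) =
    (fun X => X *m X + 0 *: X - (alpha * dmax)%:M).
  by apply/funext => X; rewrite scale0r addr0.
have solP := scalar_quadratic_sol (n := n) dp.
have dq' t : t <= T -> is_derive t 1 q (q t ^+ 2 + 0 * q t - alpha * dmax).
  by move=> /dq; rewrite mul0r addr0.
have solQ := scalar_quadratic_sol (n := n) dq'.
rewrite pT in solP; rewrite qT in solQ.
exists C; split=> //; split.
  move=> C' [solC' nz'] t tT; have [_ nz] := mC.
  apply: (riccati_ivp_unique (mx_ivp_sol_on t solC') (mx_ivp_sol_on t solC)) => //.
  - by move=> s /andP[_ sT]; exact: nz'.
  - by move=> s /andP[_ sT]; exact: nz.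
split; first by move=> t /hC[].
split; first by exists (fun t => (p t)%:M).
split; first by rewrite QE; exists (fun t => (q t)%:M).
move=> P Q hP; rewrite QE => hQ t tT.
have -> := quadratic_ivp_unique hP solP tT.
have -> := quadratic_ivp_unique hQ solQ tT.
have [_ _ nlo nhi] := hC t tT.
have SE A (r : R) : S *m (A - r *: Lam) *m S = S *m A *m S - r%:M.
  by rewrite mulmxBr mulmxBl -scalemxAr -scalemxAl SLS scalemx1.
split; [|split].
- split; first by rewrite /symmx tr_scalar_mx.
  by move=> v v0; rewrite -/(bform _ _ _) bform_scalar mulr_gt0 ?p0 ?sqn_gt0.
- by rewrite /loewner_le -SE; exact: nnd_conj.
- rewrite /loewner_le -opprB -SE -mulNmx -mulmxN opprB; exact: nnd_conj.
Qed.
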